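(* Let $\mathfrak{B}_n$ be the group of signed permutations of $\{\pm1,\dots,\pm n\}$ (bijections $\pi$ with $\pi(-i)=-\pi(i)$), written in window notation $\pi=\pi_1\cdots\pi_n$ with $\pi_i=\pi(i)$. Let $\mathrm{negs}(\pi)=|\{i\in[n]:\pi_i<0\}|$, $\mathrm{inv}_A(\pi)=|\{1\le i<j\le n:\pi_i>\pi_j\}|$ and $\mathrm{inv}_B(\pi)=\mathrm{inv}_A(\pi)+|\{1\le i<j\le n:-\pi_i>\pi_j\}|+\mathrm{negs}(\pi)$. Let $\mathfrak{B}_n^+=\{\pi\in\mathfrak{B}_n:\mathrm{inv}_B(\pi)\text{ even}\}$ and $\mathfrak{B}_n^-=\{\pi\in\mathfrak{B}_n:\mathrm{inv}_B(\pi)\text{ odd}\}$. With $\pi_0=0$, let $\mathrm{des}_B(\pi)=|\{i\in\{0,1,\dots,n-1\}:\pi_i>\pi_{i+1}\}|$, and let $\mathrm{exc}_B(\pi)=|\{i\in[n]:\pi_{|\pi_i|}>\pi_i\}\cup\{i\in[n]:\pi_i=-i\}|$. Define $B_n^{\pm}(t)=\sum_{\pi\in\mathfrak{B}_n^{\pm}}t^{\mathrm{des}_B(\pi)}$ and $\mathrm{BExc}_n^{\pm}(t)=\sum_{\pi\in\mathfrak{B}_n^{\pm}}t^{\mathrm{exc}_B(\pi)}$. Then the distribution of the coefficients of $\mathrm{BExc}_n^{+}(t)$ and of $\mathrm{BExc}_n^{-}(t)$ (and hence of $B_n^{+}(t)$ and $B_n^{-}(t)$) is asymptotically normal as $n\to\infty$.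 The random variables $X_{\mathrm{exc}_B}$ and $X_{\mathrm{des}_B}$ over $\mathfrak{B}_n^{\pm}$ (uniform distribution on $\mathfrak{B}_n^{+}$, resp. $\mathfrak{B}_n^-$) have mean $n/2$ when $n\ge 2$ and variance $(n+1)/12$ when $n\ge 3$.
   Context: To a polynomial $P(t)=\sum_k p_k t^k$ with nonnegative coefficients and $P(1)>0$ associate the random variable $X$ with $\Pr(X=k)=p_k/P(1)$. A sequence of such polynomials $P_n(t)=\sum_k p_{n,k}t^k$ has asymptotically normal coefficient distribution if, with $\mu_n,\sigma_n^2$ the mean and variance of the associated random variable, $\lim_{n\to\infty}\sup_{x\in\mathbb{R}}\left|\sum_{k\le\lfloor x\sigma_n+\mu_n\rfloor}\frac{p_{n,k}}{P_n(1)}-\Phi(x)\right|=0$, where $\Phi$ is the standard normal cumulative distribution function. For a statistic $\mathrm{stat}$ and a finite set $S$, $X_{\mathrm{stat}}$ over $S$ denotes $\mathrm{stat}(\pi)$ for $\pi$ uniform in $S$. *)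

(* Defs.v *)
From HB Require Import structures.
From mathcomp Require Import all_boot all_order all_algebra all_fingroup.
From mathcomp Require Import all_classical all_reals all_analysis.

Set Implicit Arguments.
Unset Strict Implicit.
Unset Printing Implicit Defensive.

Import Order.TTheory GRing.Theory Num.Theory.
Import numFieldNormedType.Exports.

Local Open Scope ring_scope.

(* The pair (i, b) stands for the element (-1)^b (i + 1) of {±1, ..., ±n}. *)
Definition letter (n : nat) : finType := ('I_n * bool)%type.

Definition letter_val (n : nat) (x : letter n) : int :=
  (-1) ^+ x.2 * (x.1.+1)%:Z.

Definition letter_opp (n : nat) (x : letter n) : letter n := (x.1, ~~ x.2).

Lemma letter_val_opp (n : nat) (x : letter n) :
  letter_val (letter_opp x) = - letter_val x.
Proof.
case: x => i [] /=; rewrite /letter_val /=;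
  by rewrite ?expr0 ?expr1 ?mulN1r ?mul1r ?opprK.
Qed.

Lemma letter_val_inj (n : nat) : injective (@letter_val n).
Proof.
move=> [i b] [j c]; rewrite /letter_val /= => h.
have hij : i = j.
  apply: val_inj; apply: succn_inj.
  by move: (congr1 absz h); rewrite !abszM !abszX /= !exp1n !mul1n.
by congr pair => //; case: b c h => [] [] //; rewrite hij.
Qed.

Lemma letter_val_surj (n : nat) (z : int) :
  (0 < `|z| <= n)%N -> exists x : letter n, letter_val x = z.
Proof.
case: z => [[//|k]|k] /= hk.
- by exists (Ordinal hk, false); rewrite /letter_val /= expr0 mul1r.
- by exists (Ordinal hk, true); rewrite /letter_val /= expr1 mulN1r NegzE.
Qed.

Definition signed_perms (n : nat) : {set {perm letter n}} :=
  [set pi : {perm letter n} |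
     [forall x, pi (letter_opp x) == letter_opp (pi x)]].

(* The window entry pi_k for 1 <= k <= n, together with the convention
   pi_0 = 0; the value is the junk 0 for k > n. *)
Definition window (n : nat) (pi : {perm letter n}) (k : nat) : int :=
  if k is j.+1 then
    if insub j is Some i then letter_val (pi (i, false)) else 0
  else 0.

(* In the statistics below an index i : 'I_n stands for the position i.+1,
   except in des_B where it stands for i itself. *)
Definition negs (n : nat) (pi : {perm letter n}) : nat :=
  #|[set i : 'I_n | window pi i.+1 < 0]|.

Definition inv_A (n : nat) (pi : {perm letter n}) : nat :=
  #|[set ij : 'I_n * 'I_n |
       (ij.1 < ij.2)%N && (window pi ij.1.+1 > window pi ij.2.+1)]|.

Definition inv_B (n : nat) (pi : {perm letter n}) : nat :=
  (inv_A pi +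
   #|[set ij : 'I_n * 'I_n |
        (ij.1 < ij.2)%N && (- window pi ij.1.+1 > window pi ij.2.+1)%R]| +
   negs pi)%N.

Definition des_B (n : nat) (pi : {perm letter n}) : nat :=
  #|[set i : 'I_n | window pi i > window pi i.+1]|.

Definition exc_B (n : nat) (pi : {perm letter n}) : nat :=
  #|[set i : 'I_n | window pi `|window pi i.+1|%N > window pi i.+1] :|:
    [set i : 'I_n | window pi i.+1 == - (i.+1)%:Z]|.

Definition signed_perms_plus (n : nat) : {set {perm letter n}} :=
  [set pi in signed_perms n | ~~ odd (inv_B pi)].

Definition signed_perms_minus (n : nat) : {set {perm letter n}} :=
  [set pi in signed_perms n | odd (inv_B pi)].

Section polynomials.
Local Open Scope classical_set_scope.
Variable R : realType.

Definition stat_poly (T : finType) (S : {set T}) (stat : T -> nat) : {poly R} :=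
  \sum_(x in S) 'X^(stat x).

Definition B_plus (n : nat) : {poly R} :=
  stat_poly (signed_perms_plus n) (@des_B n).
Definition B_minus (n : nat) : {poly R} :=
  stat_poly (signed_perms_minus n) (@des_B n).
Definition BExc_plus (n : nat) : {poly R} :=
  stat_poly (signed_perms_plus n) (@exc_B n).
Definition BExc_minus (n : nat) : {poly R} :=
  stat_poly (signed_perms_minus n) (@exc_B n).

Definition unif_mean (T : finType) (S : {set T}) (stat : T -> nat) : R :=
  (\sum_(x in S) (stat x)%:R) / #|S|%:R.

Definition unif_var (T : finType) (S : {set T}) (stat : T -> nat) : R :=
  (\sum_(x in S) ((stat x)%:R - unif_mean S stat) ^+ 2) / #|S|%:R.

Definition has_coef_distr (P : {poly R}) : Prop :=
  (forall k, 0 <= P`_k) /\ 0 < P.[1].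

Definition coef_prob (P : {poly R}) (k : nat) : R := P`_k / P.[1].

Definition coef_mean (P : {poly R}) : R :=
  \sum_(k < size P) k%:R * coef_prob P k.

Definition coef_var (P : {poly R}) : R :=
  \sum_(k < size P) (k%:R - coef_mean P) ^+ 2 * coef_prob P k.

Definition std_normal_cdf (x : R) : R := fine (normal_prob 0 1 `]-oo, x]).

Definition normal_distance (P : {poly R}) : R :=
  sup [set `| (\sum_(k < size P |
                 k%:Z <= Num.floor (x * Num.sqrt (coef_var P) + coef_mean P))
                coef_prob P k)
              - std_normal_cdf x | | x in [set: R]].

(* Positivity of P_n(1) is only required eventually: for signed permutations
   the odd class is empty when n = 0. *)
Definition asymptotically_normal (P : nat -> {poly R}) : Prop :=
  (\forall n \near \oo, has_coef_distr (P n)) /\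
  normal_distance (P n) @[n --> \oo] --> (0 : R).

End polynomials.

(* Main.v *)
Require Import Defs.
From HB Require Import structures.
From mathcomp Require Import all_boot all_order all_algebra all_fingroup.
From mathcomp Require Import all_classical all_reals all_analysis.
From mathcomp Require Import zify ring lra polyrcf measurable_realfun.
Import Order.TTheory GRing.Theory Num.Theory.
Import numFieldNormedType.Exports.
Local Open Scope classical_set_scope.
Local Open Scope ring_scope.

Set Implicit Arguments.
Unset Strict Implicit.
Unset Printing Implicit Defensive.

(** A signed permutation is a permutation [s] together with a choice of signs.
    For fixed [s], both [des_B] and [exc_B] are sums over the positions of
    quantities that depend only on the sign at that position, while [inv_B] is
    congruent modulo 2 to the number of minus signs plus a function of [s].
    Hence sums over the signs factor.  In the sum weighted by [(-1)^inv_B] every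
    [s] but the identity contributes 0, which leaves [(1 - t)^n]; in the
    unweighted sum [s] contributes [(4 t)^p (1 + t)^(n - 2 p)], where [p] is its
    number of (linear, resp. cyclic) peaks.  Inserting the largest letter gives
    the same recurrence for both kinds of peaks, so both unweighted sums equal
    the polynomial [B_n] defined by [B_{n+1} = ((2 n + 1) t + 1) B_n +
    2 t (1 - t) B_n'].  Thus the four polynomials are [(B_n ± (1 - t)^n) / 2];
    [(1 - t)^n] does not affect the derivatives of order at most 2 at 1, which
    gives the mean and the variance, and changes the distribution function by at
    most [1 / n!].  Finally [B_n] has only negative real roots, so it is the
    generating polynomial of a sum of independent Bernoulli variables, whose
    variance tends to infinity; its asymptotic normality is proved by Stein's
    method, and is uniform by monotonicity of distribution functions. *)

Local Arguments window : simpl never.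

(** * Signed permutations and their statistics *)

Section signed_permutations.
Variable n : nat.
Implicit Types (s : 'S_n) (e : {ffun 'I_n -> bool}).

(** The bit [e i] is the sign at position [i] of the window, not the sign of the value [i]; the
    factorization over signs rests on this indexing. *)
Definition signed_fun s e (x : letter n) : letter n := (s x.1, e x.1 (+) x.2).

Lemma signed_fun_inj s e : injective (signed_fun s e).
Proof.
by move=> [i b] [j c] [] /perm_inj -> /addbI ->.
Qed.

Definition signed_perm s e : {perm letter n} := perm (@signed_fun_inj s e).

Lemma signed_permE s e x : signed_perm s e x = (s x.1, e x.1 (+) x.2).
Proof. by rewrite permE. Qed.

Lemma signed_permP s e : signed_perm s e \in signed_perms n.
Proof.
rewrite inE; apply/forallP => -[i b]; apply/eqP.
by rewrite !signed_permE /letter_opp /= addbN.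
Qed.

Definition abs_fun (pi : {perm letter n}) (i : 'I_n) : 'I_n := (pi (i, false)).1.

Lemma abs_fun_inj (pi : {perm letter n}) :
  pi \in signed_perms n -> injective (abs_fun pi).
Proof.
rewrite inE => /forallP signed i j; rewrite /abs_fun => eqij.
have opp_j := eqP (signed (j, false)); rewrite /letter_opp /= in opp_j.
have : pi (i, false) = pi (j, false) \/ pi (i, false) = pi (j, true).
  rewrite opp_j; move: eqij.
  by case: (pi (i, false)) (pi (j, false)) => a [] [b []] /= ->; auto.
by case=> /perm_inj [].
Qed.

Lemma signed_perm_surj (pi : {perm letter n}) :
  pi \in signed_perms n -> exists s, exists e, pi = signed_perm s e.
Proof.
move=> signed; have inj := abs_fun_inj signed.
exists (perm inj), [ffun i => (pi (i, false)).2].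
apply/permP => -[i b]; rewrite signed_permE permE ffunE /=.
move: signed; rewrite inE => /forallP /(_ (i, false)) /eqP.
rewrite /letter_opp /abs_fun /=; case: b => [->|_]; last by rewrite addbF -surjective_pairing.
by rewrite addbT.
Qed.

Lemma signed_perm_inj s s' e e' :
  signed_perm s e = signed_perm s' e' -> s = s' /\ e = e'.
Proof.
move=> eqse; have eqi i := congr1 (fun p : {perm letter n} => p (i, false)) eqse.
split; [apply/permP | apply/ffunP] => i; have := eqi i;
  by rewrite /= !signed_permE /= !addbF => -[].
Qed.

Lemma big_signed_perms (V : nmodType) (F : {perm letter n} -> V) :
  \sum_(pi in signed_perms n) F pi = \sum_s \sum_e F (signed_perm s e).
Proof.
rewrite pair_bigA /= -(big_imset (h := fun p => signed_perm p.1 p.2) F) /=.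
  apply: eq_bigl => pi; apply/idP/imsetP => [/signed_perm_surj[s [e ->]]|].
    by exists (s, e).
  by move=> [[s e] _ ->]; apply: signed_permP.
by move=> [s e] [s' e'] _ _ /= /signed_perm_inj [-> ->].
Qed.

Lemma window_signed_perm s e (i : 'I_n) :
  window (signed_perm s e) i.+1 = (-1) ^+ e i * (s i).+1%:Z.
Proof.
by rewrite /window valK /letter_val signed_permE /= addbF.
Qed.

Lemma negs_signed_perm s e : negs (signed_perm s e) = (\sum_i e i)%N.
Proof.
rewrite /negs -sum1dep_card big_mkcond /=; apply: eq_bigr => i _.
have -> : (window (signed_perm s e) i.+1 < 0) = e i.
  by rewrite window_signed_perm; case: (e i); rewrite ?expr1 ?expr0 ?mulN1r ?mul1r //; lia.
by case: (e i).
Qed.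

Definition abs_odd_inv s : bool :=
  odd (\sum_(ij : 'I_n * 'I_n) ((ij.1 < ij.2)%N && (s ij.2 < s ij.1)%N)).

Lemma abs_odd_inv1 : abs_odd_inv 1 = false.
Proof.
rewrite /abs_odd_inv big1 // => -[i j] _ /=; rewrite !perm1.
by case: ltngtP.
Qed.

(** Take [i < j]. If [|π_i| > |π_j|], exactly one of [π_i > π_j] and [-π_i > π_j] holds; otherwise
    both or neither hold, according to the sign of [π_j]. Modulo 2 the pair thus counts an inversion
    of [s], whatever the signs. *)
Lemma odd_inv_B s e :
  odd (inv_B (signed_perm s e)) = abs_odd_inv s (+) odd (\sum_i e i).
Proof.
rewrite /inv_B oddD negs_signed_perm; congr (_ (+) _).
rewrite /inv_A -!sum1dep_card !(big_mkcond (fun _ => _ && _)) /= -big_split /=.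
rewrite /abs_odd_inv !(big_morph odd oddD (erefl _)).
apply: eq_bigr => -[i j] _ /=; rewrite !window_signed_perm.
case: ltnP => //= lt_ij.
have : s i != s j by rewrite (inj_eq perm_inj) neq_ltn lt_ij.
rewrite -val_eqE /=.
case: (e i); case: (e j); rewrite ?expr1 ?expr0 ?mulN1r ?mul1r;
  case: ltngtP => // ? _; do ?[case: Order.TotalTheory.ltP => ? //]; rewrite //=; lia.
Qed.

End signed_permutations.

(** * The statistics as sums of terms depending on one sign each *)

Section statistics.
Variable n : nat.
Implicit Types (s : 'S_n) (e : {ffun 'I_n -> bool}).

(** The condition at [i] involves the signs at [i] and at [s i]. It splits into a term in [e i] and
    a term in [e (s i)], and the latter is reindexed along [s]. The clause [π_i = -i] supplies the
    equality case of [s (s j) <= s j]. *)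
Lemma exc_B_signed_perm s e :
  exc_B (signed_perm s e) =
  (\sum_j (if e j then (s (s j) <= s j)%N else (j < s j)%N))%N.
Proof.
pose f j := (~~ e j && (j < s j)%N : nat).
transitivity (\sum_j ((e j && (s (s j) <= s j)%N) + f (s j)))%N; last first.
  have fs : (\sum_j f (s j) = \sum_j f j)%N.
    by rewrite [RHS](reindex_inj (@perm_inj _ s)).
  rewrite big_split /= fs -big_split /=.
  by apply: eq_bigr => j _; rewrite /f; case: (e j); rewrite ?addn0.
rewrite /exc_B -sum1_card big_mkcond /=; apply: eq_bigr => i _.
rewrite !inE window_signed_perm abszM absz_sign mul1n absz_nat window_signed_perm /f.
have : (s (s i) == s i :> nat) = (s i == i :> nat).
  by rewrite !val_eqE (inj_eq perm_inj).
have : (s i == i :> nat) -> e (s i) = e i by move=> /eqP /val_inj ->.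
move: (e (s i)) (e i) => x y.
move: (nat_of_ord (s (s i))) (nat_of_ord (s i)) (nat_of_ord i) => c b a.
case: x y => [] []; rewrite ?expr1 ?expr0 ?mulN1r ?mul1r /= => h1 h2.
all: do ?[case: ifP => h3]; lia.
Qed.


(* The word of [s] read from position 1, preceded by 0 and followed by letters
   larger than n. *)
Definition word s (k : nat) : nat :=
  if k is j.+1 then
    if insub j is Some i then (s (i : 'I_n)).+1 else (n + k)%N
  else 0%N.

Lemma word_ord s (i : 'I_n) : word s i.+1 = (s i).+1.
Proof. by rewrite /word valK. Qed.

Lemma word_last s k : (n <= k)%N -> word s k.+1 = (n + k.+1)%N.
Proof. by rewrite leqNgt => nk; rewrite /word insubN. Qed.

Definition asc s (k : nat) : bool := (word s k < word s k.+1)%N.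

Lemma asc0 s : asc s 0.
Proof. by rewrite /asc /word; case: insub => [i|]; rewrite ?addnS. Qed.

Lemma word_le s k : (k <= n)%N -> (word s k <= n)%N.
Proof. by case: k => // k lt_kn; rewrite (word_ord s (Ordinal lt_kn)). Qed.

Lemma asc_last s : asc s n.
Proof. by rewrite /asc word_last // (leq_ltn_trans (word_le s _)) //; lia. Qed.

Lemma word_neq s k : (k < n)%N -> word s k != word s k.+1.
Proof.
case: k => [|k] lt_kn; first by rewrite (word_ord s (Ordinal lt_kn)).
rewrite (word_ord s (Ordinal lt_kn)) (word_ord s (Ordinal (ltnW lt_kn))) eqSS.
by rewrite val_eqE (inj_eq perm_inj) -val_eqE /= neq_ltn ltnSn.
Qed.

(** A descent is either an ascent of absolute values with a minus on the right, or a descent of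
    absolute values with a plus on the left. The second kind is moved one index down so that both
    refer to the same sign. *)
Lemma des_B_signed_perm s e :
  des_B (signed_perm s e) =
  (\sum_(i < n) (if e i then asc s i else ~~ asc s i.+1))%N.
Proof.
pose E k := if k is j.+1 then oapp e false (insub j) else false.
have E_ord (i : 'I_n) : E i.+1 = e i by rewrite /E valK.
have windowE k : (k <= n)%N ->
    window (signed_perm s e) k = (-1) ^+ E k * (word s k)%:Z.
  case: k => [|k] lt_kn; first by rewrite mulr0.
  rewrite (window_signed_perm s e (Ordinal lt_kn)) (word_ord s (Ordinal lt_kn)).
  by rewrite (E_ord (Ordinal lt_kn)).
(* The boundary letters make 0 and [n] ascents, so [g] vanishes at both ends and the shift loses
   nothing. *)
pose g k : nat := ~~ asc s k && ~~ E k.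
have g_shift : (\sum_(i < n) g i = \sum_(i < n) g i.+1)%N.
  have [g0 gn] : g 0%N = 0%N /\ g n = 0%N by rewrite /g asc0 asc_last.
  have : (\sum_(i < n.+1) g i = \sum_(i < n.+1) g i)%N by [].
  by rewrite {1}big_ord_recr big_ord_recl /= g0 gn addn0 add0n.
transitivity (\sum_(i < n) ((asc s i && e i) + g i))%N.
  rewrite /des_B -sum1dep_card big_mkcond /=; apply: eq_bigr => i _.
  rewrite !windowE // 1?ltnW // E_ord /g /asc.
  have := word_neq s (ltn_ord i).
  have : E i -> (0 < word s i)%N by case: (val i) => //= k; rewrite /word; case: insub => //=; lia.
  move: (E i) (e i) (word s i) (word s i.+1) => x y a b.
  case: x y => [] []; rewrite ?expr1 ?expr0 ?mulN1r ?mul1r /= => h1 h2;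
    do ?[case: Order.TotalTheory.ltP => ?]; do ?[case: ltnP => ?]; rewrite //=; lia.
rewrite big_split /= g_shift -big_split /=; apply: eq_bigr => i _.
by rewrite /g E_ord; case: (e i); rewrite /= ?andbT ?andbF ?addn0.
Qed.

End statistics.

(** * Summation over the signs for a fixed underlying permutation *)

Section sign_sums.
Variables (A : comNzRingType) (n : nat).
Implicit Types (t q : A) (a b : 'I_n -> bool).

(** Distributivity. The case [q = -1] serves the sum weighted by the parity of [inv_B], the case
    [q = 1] the unweighted one. *)
Lemma sum_signs t q a b :
  \sum_(e : {ffun 'I_n -> bool})
    q ^+ (\sum_i e i)%N * t ^+ (\sum_i (if e i then a i else ~~ b i))%N =
  \prod_i (t ^+ (~~ b i) + q * t ^+ a i).
Proof.
pose F i (c : bool) := q ^+ c * t ^+ (if c then a i else ~~ b i).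
rewrite [RHS](eq_bigr (fun i => \sum_c F i c)); last first.
  by move=> i _; rewrite big_bool /F expr0 expr1 mul1r addrC.
rewrite bigA_distr_bigA /=; apply: eq_bigr => e _.
rewrite /F !expr_sum -big_split /=; apply: eq_bigr => i _; congr (_ * _).
Qed.

(* A peak contributes [2 t], a valley [2], any other index [1 + t]. *)
Lemma prod_balanced t a b :
  (\sum_i a i = \sum_i b i)%N ->
  \prod_i (t ^+ (~~ b i) + t ^+ a i) =
  (4%:R * t) ^+ (\sum_i (a i && ~~ b i)) *
  (1 + t) ^+ (n - (\sum_i (a i && ~~ b i)).*2).
Proof.
move=> balanced; pose P := (\sum_i (a i && ~~ b i))%N; rewrite -/P.
pose V := (\sum_i (~~ a i && b i))%N; pose W := (\sum_i (a i == b i))%N.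
(* Adding the indices where both bits hold turns the two counts into the sums of [a] and of [b]. *)
have PV : P = V.
  apply: (@addIn (\sum_i (a i && b i))%N); rewrite -!big_split /=.
  transitivity (\sum_i a i)%N; first by apply: eq_bigr => i _; case: (a i); case: (b i).
  by rewrite balanced; apply: eq_bigr => i _; case: (a i); case: (b i).
have PVW : (P + V + W = n)%N.
  rewrite /P /V /W -!big_split /= -[RHS]card_ord -sum1_card.
  by apply: eq_bigr => i _; case: (a i); case: (b i).
have -> : (n - P.*2 = W)%N by lia.
have -> : 4%:R * t = 2%:R * t * 2%:R by ring.
rewrite exprMn {2}PV /P /V /W !expr_sum -!big_split /=; apply: eq_bigr => i _.
by case: (a i); case: (b i); rewrite /= ?expr0 ?expr1; ring.
Qed.

End sign_sums.

Section generating_functions.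
Variables (A : comNzRingType) (n : nat) (t : A).
Variables (stat : {perm letter n} -> nat) (a b : 'S_n -> 'I_n -> bool).
Hypothesis statE : forall s e,
  stat (signed_perm s e) = (\sum_i (if e i then a s i else ~~ b s i))%N.

(** An index whose two bits differ contributes the factor [t ^+ c - t ^+ c = 0]. Only the identity
    has no such index, and each of its factors is [1 - t]. *)
Lemma signed_gf :
  (forall s, a s =1 b s -> s = 1%g) -> a 1%g =1 xpredT -> b 1%g =1 xpredT ->
  \sum_(pi in signed_perms n) (-1) ^+ inv_B pi * t ^+ stat pi = (1 - t) ^+ n.
Proof.
move=> ab1 a1 b1; rewrite big_signed_perms.
transitivity (\sum_(s : 'S_n) (-1) ^+ abs_odd_inv s *
    \prod_i (t ^+ (~~ b s i) + (-1) * t ^+ a s i)).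
  apply: eq_bigr => s _; rewrite -sum_signs big_distrr /=.
  apply: eq_bigr => e _; rewrite statE mulrA -signr_odd odd_inv_B signr_addb.
  by rewrite signr_odd.
rewrite (bigD1 1%g) //= abs_odd_inv1 mul1r [X in _ + X]big1 ?addr0.
  rewrite (eq_bigr (fun=> 1 - t)) ?prodr_const ?card_ord // => i _.
  by rewrite a1 b1 mulN1r.
move=> s s_neq1.
have [i neq_ab|eq_ab] := pickP (fun i => a s i != b s i); last first.
  by case/eqP: s_neq1; apply: ab1 => i; apply/eqP; rewrite -[_ == _]negbK eq_ab.
rewrite (bigD1 i) //=; case: (a s i) (b s i) neq_ab => [] [] //= _;
  by rewrite mulN1r subrr mul0r mulr0.
Qed.

Definition npeaks (s : 'S_n) : nat := (\sum_i (a s i && ~~ b s i))%N.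

Lemma unsigned_gf :
  (forall s, \sum_i a s i = \sum_i b s i)%N ->
  \sum_(pi in signed_perms n) t ^+ stat pi =
  \sum_(s : 'S_n) (4%:R * t) ^+ npeaks s * (1 + t) ^+ (n - (npeaks s).*2).
Proof.
move=> balanced; rewrite big_signed_perms; apply: eq_bigr => s _.
rewrite -prod_balanced //.
rewrite [RHS](eq_bigr (fun i => t ^+ (~~ b s i) + 1 * t ^+ a s i)); last first.
  by move=> i _; rewrite mul1r.
rewrite -sum_signs; apply: eq_bigr => e _.
by rewrite expr1n mul1r statE.
Qed.

End generating_functions.

(** * The exceedance bits and the ascent bits satisfy the hypotheses on [a] and [b] *)

Section position_bits.
Variable n : nat.
Implicit Type s : 'S_n.

(** The values [s j] and the indices [j] have the same sum, so no inequality can be strict. *)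
Lemma perm_le_id s : (forall j, s j <= j)%N -> s = 1%g.
Proof.
move=> le_s; apply/permP => j; rewrite perm1; apply/val_inj/eqP.
rewrite eqn_leq le_s /=.
have : (\sum_i s i = \sum_(i < n) i)%N by rewrite [RHS](reindex_inj (@perm_inj _ s)).
rewrite (bigD1 j) //= [RHS](bigD1 j) //= => eq_sum.
have : (\sum_(i < n | i != j) s i <= \sum_(i < n | i != j) i)%N.
  by apply: leq_sum => i _.
by rewrite -(leq_add2l (s j)) eq_sum leq_add2r.
Qed.

Definition anti_exc_next s (j : 'I_n) : bool := (s (s j) <= s j)%N.
Definition anti_exc s (j : 'I_n) : bool := (s j <= j)%N.

(** Equality of the bits would carry an exceedance at [j] to the larger index [s j], and so on
    without end; hence the induction on [n - j]. *)
Lemma exc_bits_eq s : anti_exc_next s =1 anti_exc s -> s = 1%g.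
Proof.
move=> eq_exc; apply: perm_le_id => j.
move: {2}(n - j)%N (leqnn (n - j)) => m; elim: m j => [|m IHm] j le_m.
  by have := ltn_ord j; lia.
rewrite leqNgt; apply/negP => lt_j.
have /IHm : (n - s j <= m)%N by have := ltn_ord (s j); lia.
have := eq_exc j; rewrite /anti_exc_next /anti_exc => ->; lia.
Qed.

Lemma exc_bits_balanced s : (\sum_j anti_exc_next s j = \sum_j anti_exc s j)%N.
Proof. by rewrite [RHS](reindex_inj (@perm_inj _ s)). Qed.

Lemma exc_B_bits s e : exc_B (signed_perm s e) =
  (\sum_j (if e j then anti_exc_next s j else ~~ anti_exc s j))%N.
Proof. by rewrite exc_B_signed_perm; apply: eq_bigr => j _; rewrite ltnNge. Qed.

Definition asc_left s (i : 'I_n) : bool := asc s i.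
Definition asc_right s (i : 'I_n) : bool := asc s i.+1.

(** The initial ascent propagates through the whole word, which is therefore increasing; then
    [j <= s j] for all [j], and the inverse of [s] is handled by [perm_le_id]. *)
Lemma asc_bits_eq s : asc_left s =1 asc_right s -> s = 1%g.
Proof.
move=> eq_asc.
have asc_all k : (k <= n)%N -> asc s k.
  elim: k => [|k IHk] lt_kn; first exact: asc0.
  by have := eq_asc (Ordinal lt_kn); rewrite /asc_left /asc_right /= => <-; apply/IHk/ltnW.
have ge_word k : (k <= n)%N -> (k <= word s k)%N.
  by elim: k => // k IHk lt_kn; apply: leq_ltn_trans (IHk (ltnW lt_kn)) (asc_all k (ltnW lt_kn)).
have le_s (j : 'I_n) : (j <= s j)%N by have := ge_word j.+1 (ltn_ord j); rewrite word_ord.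
apply/eqP; rewrite -invg_eq1; apply/eqP/perm_le_id => j.
by rewrite (leq_trans (le_s _)) // permKV.
Qed.

Lemma asc_bits_balanced s : (\sum_i asc_left s i = \sum_i asc_right s i)%N.
Proof.
have : (\sum_(i < n.+1) asc s i = \sum_(i < n.+1) asc s i)%N by [].
rewrite {1}big_ord_recr big_ord_recl /= asc0 asc_last addnC => /addnI eq_sum.
exact: eq_sum.
Qed.

Lemma word1 k : (k <= n)%N -> word (1%g : 'S_n) k = k.
Proof. by case: k => // k lt_kn; rewrite (word_ord 1%g (Ordinal lt_kn)) perm1. Qed.

Lemma asc1 k : (k <= n)%N -> asc (1%g : 'S_n) k.
Proof.
rewrite leq_eqVlt => /orP [/eqP ->|lt_kn]; first exact: asc_last.
by rewrite /asc !word1 // ltnW.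
Qed.

End position_bits.

Section type_B_sums.
Variables (A : comNzRingType) (n : nat) (t : A).

Definition peak_sum (pk : 'S_n -> nat) : A :=
  \sum_s (4%:R * t) ^+ pk s * (1 + t) ^+ (n - (pk s).*2).

Lemma signed_sum_exc :
  \sum_(pi in signed_perms n) (-1) ^+ inv_B pi * t ^+ exc_B pi = (1 - t) ^+ n.
Proof.
apply: (signed_gf _ (@exc_B_bits n)); first exact: exc_bits_eq.
  by move=> j; rewrite /anti_exc_next !perm1 leqnn.
by move=> j; rewrite /anti_exc !perm1 leqnn.
Qed.

Lemma signed_sum_des :
  \sum_(pi in signed_perms n) (-1) ^+ inv_B pi * t ^+ des_B pi = (1 - t) ^+ n.
Proof.
apply: (signed_gf _ (@des_B_signed_perm n)); first exact: asc_bits_eq.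
  by move=> j; apply: asc1; apply: ltnW.
by move=> j; apply: asc1.
Qed.

Lemma sum_exc : \sum_(pi in signed_perms n) t ^+ exc_B pi =
  peak_sum (npeaks (@anti_exc_next n) (@anti_exc n)).
Proof. exact: (unsigned_gf _ (@exc_B_bits n) (@exc_bits_balanced n)). Qed.

Lemma sum_des : \sum_(pi in signed_perms n) t ^+ des_B pi =
  peak_sum (npeaks (@asc_left n) (@asc_right n)).
Proof. exact: (unsigned_gf _ (@des_B_signed_perm n) (@asc_bits_balanced n)). Qed.

End type_B_sums.

(** * Peaks *)

Section perm_insertion.
Variable n : nat.

Lemma big_perm_lift (V : nmodType) (F : 'S_n.+1 -> V) :
  \sum_s F s = \sum_(s : 'S_n) \sum_i F (lift_perm i ord_max s).
Proof.
rewrite exchange_big pair_bigA /=.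
apply: (reindex (fun p : 'I_n.+1 * 'S_n => lift_perm p.1 ord_max p.2)).
apply/onW_bij/inj_card_bij; last by rewrite card_prod card_ord !card_Sn factS.
move=> [i s] [j r] /= eq_lift; have eq_ij : i = j.
  by apply: (@perm_inj _ (lift_perm i ord_max s)); rewrite {2}eq_lift !lift_perm_id.
rewrite -eq_ij in eq_lift *; congr pair; apply/permP => k.
have := congr1 (fun u : 'S_n.+1 => u (lift i k)) eq_lift.
by rewrite /= !lift_perm_lift => /lift_inj.
Qed.

(** The transposition places the largest letter between [j] and [s j] in a cycle, or makes it a
    fixed point when [j] is [ord_max]. *)
Definition cycle_insert (j : 'I_n.+1) (s : 'S_n) : 'S_n.+1 :=
  (tperm j ord_max * lift_perm ord_max ord_max s)%g.

Lemma cycle_insert_id j s : cycle_insert j s j = ord_max.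
Proof. by rewrite permM tpermL lift_perm_id. Qed.

Lemma big_perm_cycle (V : nmodType) (F : 'S_n.+1 -> V) :
  \sum_s F s = \sum_(s : 'S_n) \sum_j F (cycle_insert j s).
Proof.
rewrite exchange_big pair_bigA /=.
apply: (reindex (fun p : 'I_n.+1 * 'S_n => cycle_insert p.1 p.2)).
apply/onW_bij/inj_card_bij; last by rewrite card_prod card_ord !card_Sn factS.
move=> [i s] [j r] /= eq_ins; have eq_ij : i = j.
  by apply: (@perm_inj _ (cycle_insert i s)); rewrite {2}eq_ins !cycle_insert_id.
rewrite -eq_ij in eq_ins *; congr pair; apply/permP => k.
have := congr1 (fun u : 'S_n.+1 => u (lift ord_max k)) (mulgI (tperm i ord_max) _ _ eq_ins).
by rewrite /= !lift_perm_lift => /lift_inj.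
Qed.

End perm_insertion.

(** Inserting the largest letter creates one peak and destroys [c i] of the [p] old ones, so [2 p]
    of the places leave the number of peaks unchanged. *)
Lemma sum_choices (V : nmodType) (F : nat -> V) (n p : nat) (c v : 'I_n -> nat) :
  (forall i, c i <= 1)%N -> (\sum_i c i = p.*2)%N ->
  (forall i, v i + c i = p.+1)%N ->
  \sum_i F (v i) = F p *+ p.*2 + F p.+1 *+ (n - p.*2).
Proof.
move=> c_le1 sum_c vc.
transitivity (\sum_i (F p *+ c i + F p.+1 *+ (1 - c i))).
  apply: eq_bigr => i _; have := c_le1 i; have := vc i.
  case: (c i) => [|[|//]]; first by rewrite addn0 => -> _; rewrite mulr0n mulr1n add0r.
  by rewrite addn1 => -[->] _; rewrite mulr1n mulr0n addr0.
rewrite big_split /= !sumrMnr sum_c; congr (_ + _ *+ _).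
have : (\sum_i (1 - c i) + \sum_i c i = n)%N.
  rewrite -big_split /= -[RHS]card_ord -sum1_card; apply: eq_bigr => i _.
  by rewrite subnK.
by rewrite sum_c => sum_n; rewrite -[RHS](congr1 (subn^~ p.*2) sum_n) addnK.
Qed.

(** Of the [n + 1] places for the largest letter, [2 p + 1] keep the number [p] of peaks and the
    other [n - 2 p] raise it by one. Since [F] is arbitrary, this determines the distribution of
    [pk]. *)
Definition peak_recurrence (pk : forall n, 'S_n -> nat) : Prop :=
  forall (V : nmodType) (n : nat) (F : nat -> V),
  \sum_(s : 'S_n.+1) F (pk _ s) =
  \sum_(s : 'S_n) (F (pk _ s) *+ (pk _ s).*2.+1 +
                   F (pk _ s).+1 *+ (n - (pk _ s).*2)).

(** The peak itself is the value [s j]; it is indexed by its predecessor [j] in the cycle. *)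
Definition cyc_peak n (s : 'S_n) (j : 'I_n) : bool := anti_exc_next s j && ~~ anti_exc s j.
Definition cyc_peaks n (s : 'S_n) : nat := npeaks (@anti_exc_next n) (@anti_exc n) s.

Lemma cyc_peaks_recurrence : peak_recurrence cyc_peaks.
Proof.
move=> V n F; rewrite big_perm_cycle; apply: eq_bigr => s _.
rewrite big_ord_recr /=.
pose wd := widen_ord (leqnSn n).
have wdE k : wd k = lift ord_max k by apply: val_inj; rewrite /= /bump leqNgt ltn_ord.
have wd_inj : injective wd by move=> x y; rewrite !wdE => /lift_inj.
have sum_last (u : 'S_n.+1) : cyc_peaks u = (\sum_(k < n) cyc_peak u (wd k))%N.
  rewrite /cyc_peaks /npeaks big_ord_recr /= [X in (_ + X)%N](_ : _ = 0%N) ?addn0 //.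
  by rewrite /anti_exc leqNgt ltnNge -ltnS ltn_ord andbF.
have fix_last : cyc_peaks (cycle_insert ord_max s) = cyc_peaks s.
  rewrite sum_last; apply: eq_bigr => k _.
  rewrite /cycle_insert tperm1 mul1g /cyc_peak /anti_exc_next /anti_exc wdE.
  by rewrite !lift_perm_lift -!wdE.
rewrite fix_last mulrSr addrAC; congr (_ + _).
(* Insertion between [j] and [s j] can destroy only the peaks at the values [s j] and [j], which are
   indexed by [j] and [s^-1 j]. Being adjacent in a cycle, they are not both peaks. *)
pose c j := (cyc_peak s j + cyc_peak s (s^-1 j)%g)%N.
apply: (@sum_choices _ _ _ _ c) => [j||j].
- rewrite /c /cyc_peak /anti_exc_next /anti_exc permKV.
  by case: (s j <= j)%N; case: (s (s j) <= s j)%N; case: (j <= s^-1%g j)%N.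
- rewrite /c big_split /= -addnn; congr (_ + _)%N.
  by rewrite [RHS](reindex_inj (@perm_inj _ s^-1%g)).
rewrite -/wd sum_last /c.
have insE k : k != j -> cycle_insert (wd j) s (wd k) = wd (s k).
  move=> neq_kj; rewrite permM tpermD ?wdE ?lift_perm_lift //.
    by rewrite -!wdE (inj_eq wd_inj) eq_sym.
  by rewrite neq_lift.
have ins_max : cycle_insert (wd j) s ord_max = wd (s j).
  by rewrite permM tpermR wdE lift_perm_lift -wdE.
(* Balance at each index: [j] now carries the new peak, [s^-1 j] loses its peak if it had one, and
   the other indices keep theirs. *)
have peakE k : (cyc_peak (cycle_insert (wd j) s) (wd k) +
    (if k == j then cyc_peak s k : nat else 0%N) +
    (if k == (s^-1 j)%g then cyc_peak s k : nat else 0%N) =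
    cyc_peak s k + (k == j))%N.
  have -> : (k == (s^-1 j)%g) = (s k == j).
    by apply/eqP/eqP => [->|<-]; rewrite ?permKV ?permK.
  have [->|neq_kj] := eqVneq k j.
    rewrite /cyc_peak /anti_exc_next /anti_exc cycle_insert_id ins_max.
    rewrite -ltnNge /= ltn_ord ltnW //=.
    by case: eqP => [->|_]; rewrite ?leqnn ?andbF ?addn0 // addnC.
  rewrite addn0 /cyc_peak /anti_exc_next /anti_exc insE //.
  have [eq_sk|neq_sk] := eqVneq (s k) j; last by rewrite insE // !addn0.
  by rewrite eq_sk cycle_insert_id /= leqNgt ltn_ord /= -eq_sk addn0.
have := eq_bigr (idx := 0%N) (op := addn) (r := index_enum 'I_n) (P := xpredT)
  _ (fun k _ => peakE k).
rewrite !big_split /= -!big_mkcond /= !big_pred1_eq addnA => ->.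
by rewrite addn1 big_mkcond.
Qed.

Definition lin_peak n (s : 'S_n) (k : nat) : bool := asc s k && ~~ asc s k.+1.
Definition lin_peaks n (s : 'S_n) : nat := npeaks (@asc_left n) (@asc_right n) s.

(** Bookkeeping for the words: [d] and [d'] mark the peaks before and after an insertion at place
    [i], which moves later peaks by one index and destroys those marked at [i] and [i - 1]. *)
Lemma insertion_sum (d d' : nat -> nat) (n i : nat) : (i < n)%N ->
  (forall k, k.+1 < i -> d' k = d k)%N -> (0 < i -> d' i.-1 = 0)%N ->
  d' i = 1%N -> d' i.+1 = 0%N -> (forall k, i < k < n -> d' k.+1 = d k)%N ->
  (\sum_(k < n.+1) d' k + (d i + (0 < i) * d i.-1) = (\sum_(k < n) d k).+1)%N.
Proof.
move=> lt_in before prev at_i next after.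
have prefix : (\sum_(k < i) d' k + (0 < i) * d i.-1 = \sum_(k < i) d k)%N.
  case: i before prev {at_i next after lt_in} => [|i] before prev; first by rewrite !big_ord0.
  rewrite !big_ord_recr /= prev // addn0 mul1n; congr (_ + _)%N.
  by apply: eq_bigr => k _; apply: before; rewrite ltnS.
elim: n lt_in after => // n IHn; rewrite ltnS leq_eqVlt => /orP [/eqP eq_in|lt_in] after.
  rewrite -eq_in !big_ord_recr /= at_i next -prefix addn0 addn1 addSn.
  by rewrite -addnA [X in (_ + X).+1]addnC.
rewrite big_ord_recr /= [in RHS]big_ord_recr /= after ?lt_in //=.
by rewrite addnAC IHn // => k /andP [lt_ik lt_kn]; apply: after; rewrite lt_ik ltnW.
Qed.

(** * Effect on a word and its ascents of inserting the largest letter *)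

Section word_insertion.
Variables (n : nat) (s : 'S_n) (i : 'I_n.+1).
Let r : 'S_n.+1 := lift_perm i ord_max s.

Lemma word_lift_before k : (k <= i)%N -> word r k = word s k.
Proof.
case: k => // k lt_ki; have lt_kn : (k < n)%N by have := ltn_ord i; lia.
have lt_kn1 : (k < n.+1)%N := ltnW lt_kn.
rewrite (word_ord s (Ordinal lt_kn)) (word_ord r (Ordinal lt_kn1)).
have -> : Ordinal lt_kn1 = lift i (Ordinal lt_kn).
  by apply: val_inj; rewrite /= /bump leqNgt lt_ki.
by rewrite lift_perm_lift lift_max.
Qed.

Lemma word_lift_at : word r i.+1 = n.+1.
Proof. by rewrite word_ord lift_perm_id. Qed.

Lemma word_lift_after k : (i < k <= n)%N -> word r k.+1 = word s k.
Proof.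
case: k => // k /andP [lt_ik lt_kn].
have lt_kn1 : (k.+1 < n.+1)%N := lt_kn.
rewrite (word_ord s (Ordinal lt_kn)) (word_ord r (Ordinal lt_kn1)).
have -> : Ordinal lt_kn1 = lift i (Ordinal lt_kn).
  by apply: val_inj; rewrite /= /bump -ltnS lt_ik.
by rewrite lift_perm_lift lift_max.
Qed.

Lemma asc_lift_before k : (k < i)%N -> asc r k = asc s k.
Proof. by move=> lt_ki; rewrite /asc !word_lift_before // ltnW. Qed.

Lemma asc_lift_at : asc r i.
Proof. by rewrite /asc word_lift_at word_lift_before // ltnS word_le // -ltnS. Qed.

Lemma asc_lift_next : (i < n)%N -> asc r i.+1 = false.
Proof.
move=> lt_in; rewrite /asc word_lift_at word_lift_after ?ltnSn //.
by apply/negbTE; rewrite -leqNgt ltnW // ltnS word_le.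
Qed.

Lemma asc_lift_after k : (i < k <= n)%N -> asc r k.+1 = asc s k.
Proof.
case/andP=> lt_ik; rewrite leq_eqVlt => /orP [/eqP ->|lt_kn].
  by rewrite (asc_last r) asc_last.
by rewrite /asc !word_lift_after // ?lt_ik ?(ltnW lt_kn) // ltnW.
Qed.

End word_insertion.

Lemma lin_peaks_recurrence : peak_recurrence lin_peaks.
Proof.
move=> V n F; rewrite big_perm_lift; apply: eq_bigr => s _.
rewrite big_ord_recr /=.
have fix_last : lin_peaks (lift_perm ord_max ord_max s) = lin_peaks s.
  rewrite /lin_peaks /npeaks /asc_left /asc_right big_ord_recr /= asc_last andbF addn0.
  apply: eq_bigr => k _; rewrite asc_lift_before //.
  have [lt_kn|le_nk] := ltnP k.+1 n; first by rewrite asc_lift_before.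
  have -> : k.+1 = n by apply/eqP; rewrite eqn_leq le_nk ltn_ord.
  by rewrite asc_last (asc_lift_at s ord_max).
rewrite fix_last mulrSr addrAC; congr (_ + _).
have peak_last : (0 < n)%N -> lin_peak s n.-1 = false.
  by move=> n_gt0; rewrite /lin_peak prednK // asc_last andbF.
(* The new letter stands between the letters whose peaks have indices [j - 1] and [j]. The factor
   [0 < j] discards the truncated predecessor of 0. By [peak_last], shifting the index still meets
   every peak once. *)
pose c (j : 'I_n) := (lin_peak s j + (0 < j) * lin_peak s j.-1)%N.
apply: (@sum_choices _ _ _ _ c) => [j||j].
- rewrite /c /lin_peak; case: (nat_of_ord j) => [|k] /=; first by rewrite mul0n addn0 leq_b1.
  by case: (asc s k); case: (asc s k.+1); case: (asc s k.+2).
- rewrite /c big_split /= -addnn; congr (_ + _)%N.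
  case: n s {F fix_last c} peak_last => [|n] s peak_last.
    by rewrite /lin_peaks /npeaks !big_ord0.
  rewrite big_ord_recl mul0n add0n /lin_peaks /npeaks big_ord_recr.
  rewrite /= [X in (_ + X)%N](_ : _ = 0%N) ?addn0.
    by apply: eq_bigr => k _; rewrite mul1n.
  by move: (peak_last isT); rewrite /lin_peak /asc_left /asc_right /= => ->.
set w := widen_ord _ j; rewrite /c.
have w_next : asc (lift_perm w ord_max s) j.+1 = false.
  exact: (@asc_lift_next _ s w (ltn_ord j)).
apply: (@insertion_sum (lin_peak s) (lin_peak (lift_perm w ord_max s)) n j) => //.
- by move=> k lt_kj; rewrite /lin_peak !asc_lift_before // ltnW.
- by move=> j_gt0; rewrite /lin_peak prednK // (asc_lift_at s w) /= andbF.
- by rewrite /lin_peak (asc_lift_at s w) w_next.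
- by rewrite /lin_peak w_next.
move=> k /andP [lt_jk lt_kn].
by rewrite /lin_peak !asc_lift_after //= ?lt_jk ?(ltnW lt_kn) // ltnW.
Qed.

(** * Eulerian polynomials of type B *)

Section type_B_eulerian.
Variable R : comNzRingType.

Definition eulerian_step (n : nat) (p : {poly R}) : {poly R} :=
  (n.*2.+1%:R * 'X + 1) * p + 2%:R * 'X * (1 - 'X) * p^`().

Fixpoint eulerianB (n : nat) : {poly R} :=
  if n is m.+1 then eulerian_step m (eulerianB m) else 1.

Lemma eulerian_step_sum (I : Type) (r : seq I) n (F : I -> {poly R}) :
  eulerian_step n (\sum_(i <- r) F i) = \sum_(i <- r) eulerian_step n (F i).
Proof.
by rewrite /eulerian_step linear_sum !big_distrr -big_split.
Qed.

(** On one term of the peak expansion, the differential recurrence acts exactly as the insertion of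
    the largest letter, with [m = n - 2 p]. *)
Lemma eulerian_step_peaks p m :
  eulerian_step (m + p.*2) ((4%:R * 'X) ^+ p * (1 + 'X) ^+ m) =
  (4%:R * 'X) ^+ p * (1 + 'X) ^+ m.+1 *+ p.*2.+1 +
  (4%:R * 'X) ^+ p.+1 * (1 + 'X) ^+ m.-1 *+ m.
Proof.
(* The extra factor ['X] keeps the exponent [p] and avoids [p - 1]. *)
have XD : 'X * ((4%:R * 'X) ^+ p)^`() = p%:R * (4%:R * 'X) ^+ p :> {poly R}.
  have -> : 4%:R * 'X = 'X *+ 4 :> {poly R} by rewrite mulr_natl.
  rewrite deriv_exp derivMn derivX.
  case: p => [|p]; first by rewrite mulr0n mulr0 mul0r.
  rewrite exprS /=; move: (_ ^+ p) => Q.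
  by rewrite mulrnAr -[LHS]mulr_natl [in LHS](mulrA 'X) mulrnAr mulr1.
have DX : ((1 + 'X) ^+ m)^`() = m%:R * (1 + 'X) ^+ m.-1 :> {poly R}.
  by rewrite deriv_exp derivD derivX derivC add0r mul1r mulr_natl.
rewrite /eulerian_step derivM DX -[X in _ = X + _]mulr_natl -[X in _ = _ + X]mulr_natl !exprS.
have := XD; move: ((4%:R * 'X) ^+ p) => Q; move: (Q^`()) => D.
case: m {DX} => [|m] /=; rewrite ?exprS ?expr0; move: 'X => x xD.
  have -> : p.*2.+1%:R = 2%:R * p%:R + 1 :> {poly R} by rewrite -natr1 -muln2 natrM mulrC.
  have -> : (0 + p.*2).*2.+1%:R = 4%:R * p%:R + 1 :> {poly R}.
    by rewrite -natr1 -!muln2 !natrM; ring.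
  rewrite mulr0n !mul0r !mulr0 !addr0 !mulr1.
  have -> : 2%:R * x * (1 - x) * D = 2%:R * (1 - x) * (x * D) by ring.
  by rewrite xD; ring.
move: ((1 + x) ^+ m) => C.
have -> : (m.+1 + p.*2).*2.+1%:R = 2%:R * m%:R + 4%:R * p%:R + 3%:R :> {poly R}.
  by rewrite -!muln2 -addn1 -(addn1 m) !(natrD, natrM); ring.
have -> : p.*2.+1%:R = 2%:R * p%:R + 1 :> {poly R} by rewrite -natr1 -muln2 natrM mulrC.
have -> : m.+1%:R = m%:R + 1 :> {poly R} by rewrite natr1.
have -> : 2%:R * x * (1 - x) * (D * ((1 + x) * C) + Q * ((m%:R + 1) * C)) =
  2%:R * (1 - x) * (x * D) * ((1 + x) * C) + 2%:R * x * (1 - x) * (Q * ((m%:R + 1) * C)).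
  by ring.
rewrite xD; move: (m%:R) (p%:R) => a b.
by ring.
Qed.

Variable pk : forall n, 'S_n -> nat.
Hypothesis pk_rec : peak_recurrence pk.
Hypothesis pk_le : forall n (s : 'S_n), ((pk s).*2 <= n)%N.

Lemma peak_sum_eulerianB n : peak_sum 'X (@pk n) = eulerianB n.
Proof.
elim: n => [|n IHn]; rewrite /peak_sum.
  rewrite (eq_bigr (fun=> 1)) ?sumr_const ?card_Sn // => s _.
  by have := pk_le s; case: (pk s) => // _; rewrite expr0 mul1r.
rewrite (pk_rec n (fun k => (4%:R * 'X : {poly R}) ^+ k * (1 + 'X) ^+ (n.+1 - k.*2))).
rewrite /= -IHn /peak_sum eulerian_step_sum; apply: eq_bigr => s _.
have := pk_le s; move: (pk s) => p le_p.
have := eulerian_step_peaks p (n - p.*2); rewrite subnK // => ->.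
rewrite subSn //; congr (_ + _ * _ ^+ _ *+ _).
by rewrite doubleS subSS subnS.
Qed.

End type_B_eulerian.

(** Peaks and valleys are disjoint and, by balance, equally numerous. *)
Lemma npeaks_le n (a b : 'S_n -> 'I_n -> bool) s :
  (\sum_i a s i = \sum_i b s i)%N -> ((npeaks a b s).*2 <= n)%N.
Proof.
move=> balanced; rewrite -addnn {2}/npeaks.
have -> : (\sum_i (a s i && ~~ b s i) = \sum_i (~~ a s i && b s i))%N.
  apply: (@addIn (\sum_i (a s i && b s i))%N); rewrite -!big_split /=.
  transitivity (\sum_i a s i)%N; first by apply: eq_bigr => i _; case: (a s i); case: (b s i).
  by rewrite balanced; apply: eq_bigr => i _; case: (a s i); case: (b s i).
rewrite -big_split /= -[X in (_ <= X)%N]card_ord -sum1_card; apply: leq_sum => i _.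
by case: (a s i); case: (b s i).
Qed.

(** * Generating polynomials over the two parity classes *)

Section type_B_polynomials.
Variables (R : numFieldType) (n : nat).

Lemma exc_B_gf : \sum_(pi in signed_perms n) 'X^(exc_B pi) = eulerianB R n.
Proof.
rewrite sum_exc; apply: (@peak_sum_eulerianB R cyc_peaks cyc_peaks_recurrence).
by move=> m s; apply: npeaks_le; apply: exc_bits_balanced.
Qed.

Lemma des_B_gf : \sum_(pi in signed_perms n) 'X^(des_B pi) = eulerianB R n.
Proof.
rewrite sum_des; apply: (@peak_sum_eulerianB R lin_peaks lin_peaks_recurrence).
by move=> m s; apply: npeaks_le; apply: asc_bits_balanced.
Qed.

Section parity.
Variable stat : {perm letter n} -> nat.
Hypothesis gf : \sum_(pi in signed_perms n) 'X^(stat pi) = eulerianB R n.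
Hypothesis signed : \sum_(pi in signed_perms n) (-1) ^+ inv_B pi * 'X^(stat pi) =
  (1 - 'X) ^+ n :> {poly R}.

Let scale_half (p : {poly R}) : 2^-1 *: (p + p) = p.
Proof.
rewrite scalerDr -scalerDl [X in X *: _](_ : _ = 1) ?scale1r //.
by field.
Qed.

Lemma even_gf : \sum_(pi in signed_perms_plus n) 'X^(stat pi) =
  2^-1 *: (eulerianB R n + (1 - 'X) ^+ n).
Proof.
rewrite -gf -signed -big_split /= scaler_sumr [RHS](bigID (fun pi => odd (inv_B pi))) /=.
rewrite [X in _ = X + _]big1 ?add0r => [|pi /andP [_ odd_pi]]; last first.
  by rewrite -signr_odd odd_pi expr1 mulN1r subrr scaler0.
rewrite [LHS](eq_bigl (fun pi => (pi \in signed_perms n) && ~~ odd (inv_B pi))); last first.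
  by move=> pi; rewrite !inE.
apply: eq_bigr => pi /andP [_ even_pi].
by rewrite -signr_odd (negPf even_pi) expr0 mul1r scale_half.
Qed.

Lemma odd_gf : \sum_(pi in signed_perms_minus n) 'X^(stat pi) =
  2^-1 *: (eulerianB R n - (1 - 'X) ^+ n).
Proof.
rewrite -gf -signed -sumrB /= scaler_sumr [RHS](bigID (fun pi => odd (inv_B pi))) /=.
rewrite [X in _ = _ + X]big1 ?addr0 => [|pi /andP [_ even_pi]]; last first.
  by rewrite -signr_odd (negPf even_pi) expr0 mul1r subrr scaler0.
rewrite [LHS](eq_bigl (fun pi => (pi \in signed_perms n) && odd (inv_B pi))); last first.
  by move=> pi; rewrite !inE.
apply: eq_bigr => pi /andP [_ odd_pi].
by rewrite -signr_odd odd_pi expr1 mulN1r opprK scale_half.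
Qed.

End parity.
End type_B_polynomials.

(** * Derivatives at 1 of the type B Eulerian polynomials *)

Section moments.
Variable R : numFieldType.
Local Notation B := (eulerianB R).

Lemma natr_double n : n.*2%:R = 2%:R * n%:R :> R.
Proof. by rewrite -muln2 natrM mulrC. Qed.

Lemma natr_doubleS n : n.*2.+1%:R = 2%:R * n%:R + 1 :> R.
Proof. by rewrite -natr1 natr_double. Qed.

(** The factor [1 - 'X] vanishes at 1. Hence a derivative of the step at 1 involves no derivative of
    [p] of higher order, and the recurrences at 1 close up. *)
Lemma eulerian_step1 n (p : {poly R}) : (eulerian_step n p).[1] = n.+1.*2%:R * p.[1].
Proof.
rewrite /eulerian_step !(hornerD, hornerM, hornerN, hornerMn, hornerX, hornerC).
by rewrite natr_doubleS natr_double -natr1; ring.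
Qed.

Lemma deriv_eulerian_step1 n (p : {poly R}) :
  (eulerian_step n p)^`().[1] = n.*2.+1%:R * p.[1] + n.*2%:R * p^`().[1].
Proof.
rewrite /eulerian_step !(derivD, derivM, derivN, derivMn, derivX, derivC, deriv0).
rewrite !(hornerD, hornerM, hornerN, hornerMn, hornerX, hornerC, horner0) ?natr_doubleS.
by rewrite ?natr_double; ring.
Qed.

Lemma deriv2_eulerian_step1 n (p : {poly R}) :
  (eulerian_step n p)^`()^`().[1] =
  (4%:R * n%:R - 2%:R) * p^`().[1] + (2%:R * n%:R - 2%:R) * p^`()^`().[1].
Proof.
rewrite /eulerian_step !(derivD, derivM, derivN, derivMn, derivX, derivC, deriv0).
rewrite !(hornerD, hornerM, hornerN, hornerMn, hornerX, hornerC, horner0) ?natr_doubleS.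
by rewrite ?natr_double; ring.
Qed.

Lemma eulerianB1 n : (B n).[1] = (2 ^ n * n`!)%:R.
Proof.
elim: n => [|n IHn] /=; first by rewrite hornerE.
by rewrite eulerian_step1 IHn -natrM factS expnS -muln2; congr _%:R; ring.
Qed.

Lemma eulerianB1_gt0 n : 0 < (B n).[1].
Proof. by rewrite eulerianB1 ltr0n muln_gt0 expn_gt0 fact_gt0. Qed.

Lemma deriv_eulerianB1 n : (B n)^`().[1] = n%:R / 2%:R * (B n).[1].
Proof.
elim: n => [|n IHn] /=; first by rewrite derivC hornerE !mul0r.
rewrite deriv_eulerian_step1 eulerian_step1 IHn natr_doubleS !natr_double -natr1.
by field.
Qed.

Lemma deriv2_eulerianB1 n : (2 <= n)%N ->
  (B n)^`()^`().[1] =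
  (3%:R * n%:R ^+ 2 - 5%:R * n%:R + 1) / 12%:R * (B n).[1].
Proof.
case: n => [|[|n]] // _; elim: n => [|n IHn].
  (* At [n = 1] the coefficient [2 n - 2] of the second derivative vanishes, so the base case rests
     on the first derivative alone. The closed form is false for [B 1]. *)
  rewrite [B 2]/= deriv2_eulerian_step1 eulerian_step1 (deriv_eulerianB1 1).
  by rewrite natr_double; field.
have -> : B n.+3 = eulerian_step n.+2 (B n.+2) by [].
rewrite deriv2_eulerian_step1 eulerian_step1 IHn deriv_eulerianB1.
by rewrite natr_double -[n.+3%:R]natr1; field.
Qed.

End moments.

(** * Real-rootedness by interlacing *)

Section real_roots.
Variable R : rcfType.

Lemma coef_eulerian_step n (p : {poly R}) k :
  (eulerian_step n p)`_k.+1 =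
  (2%:R * k%:R + 3%:R) * p`_k.+1 + (2%:R * n%:R - 2%:R * k%:R + 1) * p`_k.
Proof.
have -> : eulerian_step n p =
  n.*2.+1%:R *: ('X * p) + p + 2%:R *: ('X * p^`()) - 2%:R *: ('X * ('X * p^`())).
  by rewrite /eulerian_step -!mul_polyC !polyC_natr; ring.
rewrite !(coefD, coefN, coefZ, coefXM) /= !coef_deriv natr_doubleS.
case: k => [|k] /=; first by rewrite -mulr_natl; ring.
by rewrite -[_ *+ k.+2]mulr_natl -[_ *+ k.+1]mulr_natl -[k.+2%:R]natr1; ring.
Qed.

Lemma sum_ltn (n i : nat) : (i <= n)%N -> (\sum_(j < n) (j < i) = i)%N.
Proof.
move=> le_in; rewrite -[RHS]card_ord -sum1_card -(big_ord_narrow (F := fun=> 1%N) le_in).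
by rewrite [RHS]big_mkcond.
Qed.

Lemma horner_deriv_prod n (x : nat -> R) (i : 'I_n) :
  (\prod_(j < n) ('X - (x j)%:P))^`().[x i] = \prod_(j < n | j != i) (x i - x j).
Proof.
rewrite (bigD1 i) //= derivM derivXsubC mul1r hornerD hornerM hornerXsubC subrr mul0r addr0.
by rewrite horner_prod; apply: eq_bigr => j _; rewrite hornerXsubC.
Qed.

(** In the product of the differences [x i - x j], each of the [i] larger roots contributes one
    minus sign. *)
Lemma sign_horner_deriv_prod n (x : nat -> R) (i : 'I_n) :
  (forall i j, (i < j < n)%N -> x j < x i) ->
  0 < (-1) ^+ i * (\prod_(j < n) ('X - (x j)%:P))^`().[x i].
Proof.
move=> x_decr; rewrite horner_deriv_prod -{1}(sum_ltn (ltnW (ltn_ord i))).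
rewrite expr_sum (bigD1 i) //= ltnn mul1r -big_split /=.
apply: prodr_gt0 => j neq_ji.
have [lt_ji|] := ltnP j i; first by rewrite mulN1r opprB subr_gt0 x_decr ?lt_ji /=.
rewrite leq_eqVlt eq_sym val_eqE (negPf neq_ji) /= => lt_ij.
by rewrite mul1r subr_gt0 x_decr ?lt_ij /=.
Qed.

(** The intermediate value theorem gives a root in each of [n] disjoint intervals, and a monic
    polynomial of degree [n] has no room for others. *)
Lemma roots_of_sign_changes (n : nat) (p : {poly R}) (z : nat -> R) :
  p \is monic -> size p = n.+1 ->
  (forall i, (i < n)%N -> z i.+1 < z i) ->
  (forall i, (i <= n)%N -> 0 < (-1) ^+ i * p.[z i]) ->
  exists y : nat -> R, [/\ forall i, (i < n)%N -> z i.+1 < y i < z i,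
    forall i j, (i < j < n)%N -> y j < y i & p = \prod_(i < n) ('X - (y i)%:P)].
Proof.
move=> p_monic size_p z_decr sign.
have /choice[y yP] : forall i, exists w, (i < n)%N -> (z i.+1 < w < z i) /\ root p w.
  move=> i.
  have [lt_in|_] := ltnP i n; last by exists 0.
  have [||w] := @poly_ivtoo _ p (z i.+1) (z i); first exact/ltW/z_decr.
    have := mulr_gt0 (sign i (ltnW lt_in)) (sign i.+1 lt_in).
    rewrite mulrACA -exprD addnS exprS addnn -mul2n exprM sqrrN expr1n expr1n mulr1 mulN1r.
    by rewrite oppr_gt0 mulrC.
  by rewrite in_itv /=; exists w.
have z_lt i j : (i < j <= n)%N -> z j < z i.
  elim: j => // j IHj; rewrite ltnS leq_eqVlt => /andP [/orP [/eqP ->|lt_ij] lt_jn].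
    exact: z_decr.
  by apply: lt_trans (z_decr _ lt_jn) (IHj _); rewrite lt_ij ltnW.
have y_lt i j : (i < j < n)%N -> y j < y i.
  case/andP=> lt_ij lt_jn; have /yP[/andP[_ lt_y] _] := lt_jn.
  have /yP[/andP[gt_y _] _] := ltn_trans lt_ij lt_jn.
  apply: lt_trans lt_y (le_lt_trans _ gt_y).
  move: lt_ij; rewrite leq_eqVlt => /orP [/eqP -> //|lt_ij].
  by apply/ltW/z_lt; rewrite lt_ij ltnW.
have y_inj : {in iota 0 n &, injective y}.
  move=> i j; rewrite !mem_iota /= !add0n => lt_in lt_jn eq_y.
  case: (ltngtP i j) => // lt_ij.
    by have := y_lt i j; rewrite lt_ij lt_jn eq_y ltxx => /(_ isT).
  by have := y_lt j i; rewrite lt_ij lt_in eq_y ltxx => /(_ isT).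
exists y; split=> // [i /yP[]//|].
have := @all_roots_prod_XsubC _ p [seq y i | i <- iota 0 n].
rewrite size_map size_iota size_p (monicP p_monic) scale1r big_map uniq_rootsE map_inj_in_uniq //.
rewrite iota_uniq => /(_ erefl _ isT) ->; last first.
  by apply/allP => _ /mapP [i + ->]; rewrite mem_iota => /andP [_ /yP[]].
by rewrite -[X in iota 0 X]subn0 -/(index_iota 0 n) big_mkord.
Qed.

(** At a root [x] of [B_n] the step reduces to [2 x (1 - x) B_n'(x)], whose sign alternates from
    root to root. With the signs at 0 and near minus infinity this gives [n + 1] sign changes on the
    negative axis. *)
Lemma eulerianB_real_rooted n : exists x : nat -> R,
  [/\ forall i, (i < n)%N -> x i < 0, forall i j, (i < j < n)%N -> x j < x i &
    eulerianB R n = \prod_(i < n) ('X - (x i)%:P)].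
Proof.
elim: n => [|n [x [x_lt0 x_decr Bn]]].
  by exists (fun=> 0); split=> // [i j|]; rewrite ?ltn0 ?andbF ?big_ord0.
set Q := eulerianB R n.+1; have QE : Q = eulerian_step n (eulerianB R n) by [].
have size_B : size (eulerianB R n) = n.+1 .
  by rewrite Bn -(big_mkord xpredT (fun i => 'X - (x i)%:P)) size_prod_XsubC size_iota subn0.
have lead_B : (eulerianB R n)`_n = 1.
  by have := lead_coef_prod_XsubC (index_enum 'I_n) xpredT (fun i => x i);
    rewrite -Bn lead_coefE size_B.
have Qn : Q`_n.+1 = 1.
  by rewrite QE coef_eulerian_step lead_B nth_default ?size_B // mulr0 add0r mulr1 subrr add0r.
have size_Q : size Q = n.+2.
  apply/eqP; rewrite eqn_leq; apply/andP; split; last first.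
    by rewrite ltnNge; apply/negP => le_size; move: Qn;
      rewrite nth_default // => /eqP; rewrite eq_sym oner_eq0.
  apply/leq_sizeP => -[|k] // lt_nk; rewrite QE coef_eulerian_step.
  by rewrite !nth_default ?mulr0 ?addr0 // size_B // ltnW.
have Q_monic : Q \is monic by rewrite monicE lead_coefE size_Q Qn.
have [M M_sign] : exists M, forall y, M <= y -> 0 < (-1) ^+ n.+1 * Q.[- y].
  have lead : lead_coef ((-1) ^+ n.+1 *: (Q \Po - 'X)) = 1.
    rewrite lead_coefZ lead_coef_comp ?size_polyN ?size_polyX // size_Q lead_coefN lead_coefX.
    by rewrite (monicP Q_monic) mul1r -exprMn mulN1r opprK expr1n.
  have [|M MP] := @poly_pinfty_gt_lc _ ((-1) ^+ n.+1 *: (Q \Po - 'X)); first by rewrite lead.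
  exists M => y /MP; rewrite lead hornerZ horner_comp !hornerE.
  exact: lt_le_trans.
(* The sample points are 0, the roots of [B_n] in decreasing order, and a last point to the left of
   them and of [- M]; the term [1 - w n] puts it below the smallest root. *)
pose w i := if i is j.+1 then x j else 0.
pose z i := if (i <= n)%N then w i else - Num.max M (1 - w n).
have [||y [y_itv y_lt Qy]] := @roots_of_sign_changes n.+1 Q z Q_monic size_Q.
- move=> i; rewrite ltnS leq_eqVlt /z => /orP [/eqP ->|lt_in].
    rewrite ltnn leqnn ltrNl lt_max; apply/orP; right; lra.
  rewrite lt_in ltnW //; case: i lt_in => [|i] lt_in; first exact: x_lt0.
  by apply: x_decr; rewrite ltnSn.
- move=> i; rewrite leq_eqVlt /z => /orP [/eqP ->|].
    by rewrite ltnn; apply: M_sign; rewrite le_max lexx.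
  rewrite ltnS => le_in; rewrite le_in; case: i le_in => [|i] lt_in.
    rewrite mul1r QE /eulerian_step hornerD hornerM !(hornerD, hornerM, hornerX, hornerC).
    rewrite !mulr0 !mul0r add0r addr0 mul1r Bn horner_prod; apply: prodr_gt0 => j _.
    by rewrite hornerXsubC sub0r oppr_gt0 x_lt0.
  have root_i : (eulerianB R n).[x i] = 0.
    by rewrite Bn horner_prod (bigD1 (Ordinal lt_in)) //= hornerXsubC subrr mul0r.
  rewrite QE /eulerian_step hornerD hornerM root_i mulr0 add0r Bn.
  rewrite !(hornerM, hornerD, hornerN, hornerX, hornerC).
  have := @sign_horner_deriv_prod n x (Ordinal lt_in) x_decr; rewrite /= exprS.
  set b := (_^`()).[x i] => b_sign; have xi_lt0 := x_lt0 i lt_in.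
  rewrite (_ : _ * _ = 2%:R * (- x i * (1 - x i)) * ((-1) ^+ i * b)); last by ring.
  by do 2!apply: mulr_gt0 => //; apply: mulr_gt0; lra.
exists y; split=> //.
- move=> i lt_in; have /andP [_ lt_y] := y_itv i lt_in; apply: lt_le_trans lt_y _.
  rewrite /z -ltnS lt_in; case: i lt_in => [|i] //; rewrite ltnS => lt_in.
  by apply/ltW/x_lt0.
Qed.

End real_roots.

(** * Stein's method *)

Section coefficient_sums.
Variable R : realFieldType.
Implicit Types (p q : {poly R}) (f g : nat -> R) (rs : seq R).

Definition coef_int p f : R := \sum_(k < size p) p`_k * f k.

Lemma coef_int_widen p f n : (size p <= n)%N -> coef_int p f = \sum_(k < n) p`_k * f k.
Proof.
move=> le_n; rewrite /coef_int (big_ord_widen n (fun k => p`_k * f k) le_n) big_mkcond /=.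
apply: eq_bigr => k _; case: ltnP => // le_k.
by rewrite nth_default // mul0r.
Qed.

Lemma eq_coef_int p f g : f =1 g -> coef_int p f = coef_int p g.
Proof. by move=> fg; apply: eq_bigr => k _; rewrite fg. Qed.

Lemma coef_intD p f g : coef_int p (fun k => f k + g k) = coef_int p f + coef_int p g.
Proof. by rewrite -big_split; apply: eq_bigr => k _; rewrite mulrDr. Qed.

Lemma coef_intZ p a f : coef_int p (fun k => a * f k) = a * coef_int p f.
Proof. by rewrite big_distrr; apply: eq_bigr => k _; rewrite mulrCA. Qed.

Lemma coef_int_linear p q a b f :
  coef_int (a *: p + b *: q) f = a * coef_int p f + b * coef_int q f.
Proof.
pose n := maxn (size p) (size q).
rewrite !(@coef_int_widen _ _ n) ?leq_maxl ?leq_maxr //.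
  by rewrite !big_distrr -big_split; apply: eq_bigr => k _ /=; rewrite coefD !coefZ; ring.
apply: leq_trans (size_polyD _ _) _; rewrite geq_max !(leq_trans (size_scale_leq _ _)) //.
  exact: leq_maxr.
exact: leq_maxl.
Qed.

Lemma coef_int1 p : coef_int p (fun=> 1) = p.[1].
Proof. by rewrite horner_coef; apply: eq_bigr => k _; rewrite expr1n. Qed.

Lemma coef_int_mulX p f : coef_int ('X * p) f = coef_int p (fun k => f k.+1).
Proof.
rewrite (@coef_int_widen _ _ (size p).+1); last first.
  by apply: leq_trans (size_polyMleq _ _) _; rewrite size_polyX.
rewrite big_ord_recl coefXM mul0r add0r; apply: eq_bigr => k _.
by rewrite coefXM.
Qed.

Lemma coef_int_mulXaddC p c f :
  coef_int (('X + c%:P) * p) f = coef_int p (fun k => f k.+1 + c * f k).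
Proof.
rewrite coef_intD coef_intZ mulrDl mul_polyC -[X in coef_int (X + _)]scale1r.
by rewrite coef_int_linear mul1r coef_int_mulX.
Qed.

(** Divided by [1 + r], the factor ['X + r%:P] generates a Bernoulli variable of mean [(1 + r)^-1]
    and variance [r / (1 + r) ^+ 2]. *)
Definition root_poly rs : {poly R} := \prod_(r <- rs) ('X + r%:P).
Definition root_mean rs : R := \sum_(r <- rs) (1 + r)^-1.
Definition root_var rs : R := \sum_(r <- rs) r / (1 + r) ^+ 2.

Section nonnegative_coefficients.
Variable p : {poly R}.
Hypothesis p_ge0 : forall k, 0 <= p`_k.

Lemma le_coef_int f g : (forall k, f k <= g k) -> coef_int p f <= coef_int p g.
Proof. by move=> le_fg; apply: ler_sum => k _; apply: ler_wpM2l. Qed.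

Lemma norm_coef_int_le f (K : R) : (forall k, `|f k| <= K) ->
  `|coef_int p f| <= K * p.[1].
Proof.
move=> f_le; apply: le_trans (ler_norm_sum _ _ _) _.
rewrite -coef_int1 -coef_intZ; apply: ler_sum => k _.
by rewrite normrM ger0_norm // mulr1 ler_wpM2l.
Qed.

End nonnegative_coefficients.

Lemma root_poly_coef_ge0 rs : all (>= 0) rs -> forall k, 0 <= (root_poly rs)`_k.
Proof.
elim: rs => [|r rs IHrs] /= => [_|/andP [r_ge0 /IHrs {}IHrs]] k.
  by rewrite /root_poly big_nil coef1 ler0n.
rewrite /root_poly big_cons mulrDl coefD coefXM coefCM addr_ge0 //; last exact: mulr_ge0.
by case: k.
Qed.

Lemma root_poly1 rs : (root_poly rs).[1] = \prod_(r <- rs) (1 + r).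
Proof. by rewrite /root_poly horner_prod; apply: eq_bigr => r _; rewrite !hornerE. Qed.

(* Stein's method for a sum of independent Bernoulli variables of parameters
   [(1 + r)^-1], by induction on the number of summands: adjoining the root
   [- r] amounts to averaging [f] and [g] over one more variable. *)
Lemma root_poly_stein rs f g (K : R) : all (> 0) rs ->
  (forall k, `|f k.+1 - f k - g k| <= K) ->
  (forall k, `|f k.+1 - f k - g k.+1| <= K) ->
  `|coef_int (root_poly rs) (fun k => (k%:R - root_mean rs) * f k) -
    root_var rs * coef_int (root_poly rs) g|
  <= K * root_var rs * (root_poly rs).[1].
Proof.
move=> rs_gt0; elim: rs rs_gt0 f g K =>
  [_ f g K _ _|r rs IHrs /= /andP [r_gt0 rs_gt0] f g K le0 le1].
  rewrite /root_mean /root_var !big_nil mul0r subr0 mulr0 mul0r.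
  rewrite /coef_int /root_poly big_nil size_poly1 big_ord1 /= subr0 mul0r mulr0.
  by rewrite normr0.
have P_ge0 : forall k, 0 <= (root_poly rs)`_k.
  by apply: root_poly_coef_ge0; apply: sub_all rs_gt0 => z /ltW.
have P1_ge0 : 0 <= (root_poly rs).[1].
  by rewrite root_poly1 big_seq prodr_ge0 // => z /(allP rs_gt0) /ltW z_ge0; rewrite addr_ge0.
have r1 : 1 + r != 0 by rewrite gt_eqF // addr_gt0.
have r1_gt0 : 0 < 1 + r by rewrite addr_gt0.
(* Averages over the new variable, multiplied by [1 + r]; they satisfy the hypotheses with
   [K * (1 + r)]. *)
pose ft k := f k.+1 + r * f k; pose gt k := g k.+1 + r * g k.
have {}IHrs : `|coef_int (root_poly rs) (fun k => (k%:R - root_mean rs) * ft k) -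
    root_var rs * coef_int (root_poly rs) gt|
  <= K * (1 + r) * root_var rs * (root_poly rs).[1].
  apply: IHrs => // k; rewrite mulrDr mulr1.
    rewrite (_ : _ - _ - _ = (f k.+2 - f k.+1 - g k.+1) + r * (f k.+1 - f k - g k)); last first.
      by rewrite /ft /gt; ring.
    apply: le_trans (ler_normD _ _) _; rewrite lerD // normrM gtr0_norm // mulrC.
    by rewrite ler_wpM2r // ltW.
  rewrite (_ : _ - _ - _ = (f k.+2 - f k.+1 - g k.+2) + r * (f k.+1 - f k - g k.+1)); last first.
    by rewrite /ft /gt; ring.
  apply: le_trans (ler_normD _ _) _; rewrite lerD // normrM gtr0_norm // mulrC.
  by rewrite ler_wpM2r // ltW.
(* The new variable contributes a multiple of [f k.+1 - f k], to be compared with the average of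
   [g]. The error [d] is a convex combination of the two errors bounded by hypothesis. *)
pose d k := f k.+1 - f k - ((1 + r)^-1 * g k.+1 + r / (1 + r) * g k).
have d_le k : `|d k| <= K.
  rewrite (_ : d k = (1 + r)^-1 * (f k.+1 - f k - g k.+1) +
                     r / (1 + r) * (f k.+1 - f k - g k)); last by rewrite /d; field.
  apply: le_trans (ler_normD _ _) _; rewrite !normrM !normfV.
  rewrite (gtr0_norm r1_gt0) (gtr0_norm r_gt0).
  apply: le_trans (lerD (ler_wpM2l _ (le1 k)) (ler_wpM2l _ (le0 k))) _.
  - by rewrite invr_ge0 ltW.
  - by rewrite mulr_ge0 ?invr_ge0 ?ltW.
  rewrite -mulrDl [X in X * _](_ : _ = 1) ?mul1r //; by field.
have sumE h : coef_int (root_poly (r :: rs)) h =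
    coef_int (root_poly rs) (fun k => h k.+1 + r * h k).
  by rewrite /root_poly big_cons coef_int_mulXaddC.
have -> : coef_int (root_poly (r :: rs)) (fun k => (k%:R - root_mean (r :: rs)) * f k) -
    root_var (r :: rs) * coef_int (root_poly (r :: rs)) g =
    (coef_int (root_poly rs) (fun k => (k%:R - root_mean rs) * ft k) -
     root_var rs * coef_int (root_poly rs) gt) + r / (1 + r) * coef_int (root_poly rs) d.
  rewrite !sumE -/gt /root_mean /root_var !big_cons -/(root_mean rs) -/(root_var rs).
  rewrite (@eq_coef_int _ _ (fun k => (k%:R - root_mean rs) * ft k +
    r / (1 + r) * (d k + (1 + r)^-1 * gt k))); last first.
    by move=> k; rewrite /ft /gt /d -natr1; field.
  rewrite coef_intD coef_intZ coef_intD coef_intZ.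
  by field.
apply: le_trans (ler_normD _ _) _.
apply: le_trans (lerD IHrs _) _.
  rewrite normrM; apply: ler_wpM2l (norm_coef_int_le P_ge0 d_le); exact: normr_ge0.
rewrite ger0_norm; last by rewrite divr_ge0 // ltW.
rewrite /root_var big_cons -/(root_var rs) /root_poly big_cons hornerM -/(root_poly rs).
rewrite hornerD hornerX hornerC le_eqVlt; apply/orP; left; apply/eqP.
by field.
Qed.

End coefficient_sums.

(** * Consequences of the mean value theorem on the line *)

Section derivatives.
Variable R : realType.
Implicit Types f df : R -> R.

Lemma is_derive_continuous f df : (forall x : R, is_derive x 1 f (df x)) -> continuous f.
Proof.
by move=> fP x; apply/differentiable_continuous/derivable1_diffP; case: (fP x).
Qed.

Lemma MVT_line f df a b : (forall x : R, is_derive x 1 f (df x)) -> a < b ->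
  exists2 c, a < c < b & f b - f a = df c * (b - a).
Proof.
move=> fP lt_ab; have [|c c_in eq_c] := @MVT R f df a b lt_ab (fun x _ => fP x).
  by apply: continuous_subspaceT; apply: is_derive_continuous fP.
by exists c => //; move: c_in; rewrite in_itv.
Qed.

Lemma derive_ge0_le f df a b : (forall x : R, is_derive x 1 f (df x)) ->
  (forall x, a < x < b -> 0 <= df x) -> a <= b -> f a <= f b.
Proof.
move=> fP df_ge0; rewrite le_eqVlt => /orP [/eqP -> //|lt_ab].
have [c c_in eq_c] := MVT_line fP lt_ab.
by rewrite -subr_ge0 eq_c mulr_ge0 ?df_ge0 // subr_ge0 ltW.
Qed.

Lemma derive_le0_ge f df a b : (forall x : R, is_derive x 1 f (df x)) ->
  (forall x, a < x < b -> df x <= 0) -> a <= b -> f b <= f a.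
Proof.
move=> fP df_le0; rewrite le_eqVlt => /orP [/eqP -> //|lt_ab].
have [c c_in eq_c] := MVT_line fP lt_ab.
by rewrite -subr_le0 eq_c mulr_le0_ge0 ?df_le0 // subr_ge0 ltW.
Qed.

Lemma derive_bounded_lipschitz f df (L : R) : (forall x : R, is_derive x 1 f (df x)) ->
  (forall x, `|df x| <= L) -> forall x y, `|f x - f y| <= L * `|x - y|.
Proof.
move=> fP df_le x y; wlog lt_xy : x y / x < y => [wlg|].
  have [->|] := eqVneq x y; first by rewrite !subrr normr0 mulr0.
  rewrite neq_lt => /orP [lt_xy|lt_yx]; first exact: wlg.
  by rewrite (distrC (f x)) (distrC x); apply: wlg.
have [c _ eq_c] := MVT_line fP lt_xy.
by rewrite (distrC (f x)) (distrC x) eq_c normrM ler_wpM2r.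
Qed.

End derivatives.

(** * The Gaussian density, its distribution function and Mills' ratio *)

Section standard_normal.
Variable R : realType.
Local Notation mu := (@lebesgue_measure R).

Definition phi (x : R) : R := normal_pdf 0 1 x.
Local Notation Phi := (@std_normal_cdf R).

Lemma phiE x : phi x = normal_peak 1 * expR (- x ^+ 2 / 2).
Proof. by rewrite /phi normal_pdfE ?oner_eq0 // /normal_fun subr0 expr1n. Qed.

Lemma phi_gt0 x : 0 < phi x.
Proof. by rewrite phiE mulr_gt0 ?expR_gt0 // normal_peak_gt0 ?oner_eq0. Qed.

Lemma phiN x : phi (- x) = phi x.
Proof. by rewrite !phiE sqrrN. Qed.

Lemma continuous_phi : continuous phi.
Proof. by apply: continuous_normal_pdf; rewrite oner_eq0. Qed.

Lemma is_derive_phi (x : R) : is_derive x 1 phi (- x * phi x).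
Proof.
rewrite (_ : phi = fun x => normal_peak 1 * expR (- x ^+ 2 / 2)); last first.
  by apply/funext => y; rewrite phiE.
apply: is_derive_eq.
rewrite /GRing.scale /=.
by field.
Qed.

Lemma is_derive_integralNy (f : R -> R) : continuous f ->
  (forall x, 0 <= f x <= phi x) -> forall x : R,
  is_derive x 1 (fun y => \int[mu]_(t in `]-oo, y]) f t)%R (f x).
Proof.
move=> f_cont f_le x.
(* The end point [x + 1] leaves [x] in the interior, and domination by [phi] gives integrability. *)
have [] := @continuous_FTC1 R f (BInfty _ true) x (x + 1).
- by rewrite ltrDl.
- have int_phi : mu.-integrable `]-oo, (x + 1)%R] (EFin \o phi).
    by apply: integrableS (integrable_normal_pdf 0 1).
  apply: le_integrable int_phi => //.
    by apply/measurable_EFinP; apply: measurable_funTS; apply: continuous_measurable_fun.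
  move=> y _; have /andP [f_ge0 f_phi] := f_le y.
  by rewrite /= !ger0_norm ?lee_fin // (le_trans f_ge0).
- by rewrite ltNyr.
- exact: f_cont.
move=> dF F'; apply: DeriveDef => //.
by rewrite -F' derive1E.
Qed.

Lemma is_derive_Phi (x : R) : is_derive x 1 Phi (phi x).
Proof.
apply: (@is_derive_integralNy phi continuous_phi) => y.
by rewrite lexx ltW ?phi_gt0.
Qed.

Let P := (normal_prob (0 : R) 1).

(** The identity as a random variable: its distribution function is [Phi], whose limits at both
    infinities follow. *)
Let idTR : measurableTypeR R -> R := idfun.

#[local] HB.instance Definition _ :=
  @isMeasurableFun.Build _ _ _ _ idTR (@measurable_id _ _ setT).

Lemma Phi_fin (x : R) : P `]-oo, x] = (Phi x)%:E.
Proof. by rewrite fineK // fin_num_measure. Qed.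

Lemma Phi_ge0 x : 0 <= Phi x.
Proof. by rewrite fine_ge0. Qed.

Lemma Phi_le1 x : Phi x <= 1.
Proof. by rewrite -lee_fin -Phi_fin probability_le1. Qed.

Lemma Phi_near1 (e : R) : 0 < e -> exists M : R, forall x, M < x -> 1 - Phi x < e.
Proof.
move=> e_gt0; pose X : {RV P >-> R} := idTR.
have lim : (fine \o cdf X) x @[x --> +oo] --> (1 : R) by apply: fine_cvg (cvg_cdfy1 X).
have [M [_ MP]] := (cvgrPdist_lt _ _).1 lim e e_gt0.
by exists M => x /MP; apply: le_lt_trans (ler_norm _).
Qed.

Lemma Phi_near0 (e : R) : 0 < e -> exists M : R, forall x, x < M -> Phi x < e.
Proof.
move=> e_gt0; pose X : {RV P >-> R} := idTR.
have lim : (fine \o cdf X) x @[x --> -oo] --> (0 : R) by apply: fine_cvg (cvg_cdfNy0 X).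
have [M [_ MP]] := (cvgrPdist_lt _ _).1 lim e e_gt0.
exists M => x /MP; rewrite sub0r normrN; apply: le_lt_trans; exact: ler_norm.
Qed.

Lemma Phi_le x y : x <= y -> Phi x <= Phi y.
Proof. by apply: derive_ge0_le is_derive_Phi _ => z _; rewrite ltW ?phi_gt0. Qed.

Lemma is_derive_PhiN (x : R) : is_derive x 1 (fun y => Phi (- y)) (- phi x).
Proof.
rewrite -phiN -mulrN1.
have -> : (fun y => Phi (- y)) = Phi \o (fun y => - y) by [].
apply: is_derive1_comp; exact: is_derive_Phi.
Qed.

(** The sum [Phi y + Phi (- y)] has zero derivative, and its constant value is its limit 1. *)
Lemma PhiN x : Phi (- x) = 1 - Phi x.
Proof.
have dS (z : R) : is_derive z 1 (fun y => Phi y + Phi (- y)) (phi z + - phi z).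
  by apply: is_deriveD; [apply: is_derive_Phi | apply: is_derive_PhiN].
have const y z : `|(Phi y + Phi (- y)) - (Phi z + Phi (- z))| <= 0 * `|y - z|.
  by apply: (derive_bounded_lipschitz dS) => w; rewrite subrr normr0.
apply/eqP; rewrite -subr_eq0 -normr_le0; apply/ler_addgt0Pr => e e_gt0; rewrite add0r.
have e2_gt0 : 0 < e / 2 by rewrite divr_gt0.
have [M1 M1P] := Phi_near1 e2_gt0; have [M0 M0P] := Phi_near0 e2_gt0.
pose y := Num.max M1 (- M0) + 1.
have y1 : M1 < y by rewrite /y ltr_pwDr // le_max lexx.
have y0 : - y < M0 by rewrite ltrNl /y ltr_pwDr // le_max lexx orbT.
have := const x y; rewrite mul0r normr_le0 subr_eq0 => /eqP eq_xy.
have -> : Phi (- x) - (1 - Phi x) = Phi (- y) - (1 - Phi y).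
  by rewrite !opprB !addrA ![_ + Phi _ - 1]addrAC; lra.
have := M1P y y1; have := M0P _ y0; have := Phi_ge0 (- y); have := Phi_le1 y.
rewrite ler_norml; lra.
Qed.

(* Mills' bounds; each difference is monotone and tends to 0 at infinity. *)
Lemma mills_upper x : 0 < x -> x * (1 - Phi x) <= phi x.
Proof.
move=> x_gt0; rewrite -subr_ge0.
pose u y := phi y - x * (1 - Phi y).
have du (z : R) : is_derive z 1 u (- z * phi z - x * (0 - phi z)).
  have dPhi := is_derive_Phi z; have dphi := is_derive_phi z.
  by apply: is_derive_eq; rewrite /GRing.scale /=; ring.
rewrite -/(u x); apply/ler_addgt0Pr => e e_gt0; rewrite -lerBlDr sub0r.
have [M MP] := @Phi_near1 (e / x) (divr_gt0 e_gt0 x_gt0).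
pose y := Num.max M x + 1.
have My : M < y by rewrite /y ltr_pwDr // le_max lexx.
have xy : x <= y by rewrite ltW // /y ltr_pwDr // le_max lexx orbT.
apply: le_trans (derive_le0_ge du _ xy) => [|z /andP [xz _]]; last first.
  by have := phi_gt0 z; nra.
have := MP y My; rewrite ltr_pdivlMr // /u; have := phi_gt0 y; lra.
Qed.

Lemma mills_lower x : 0 < x -> x * phi x <= (1 + x ^+ 2) * (1 - Phi x).
Proof.
move=> x_gt0.
have pos y : 0 < 1 + y ^+ 2 :> R by rewrite ltr_pwDl // sqr_ge0.
pose v y := y * phi y / (1 + y ^+ 2) - (1 - Phi y).
have dv (z : R) : is_derive z 1 v (2 * phi z / (1 + z ^+ 2) ^+ 2).
  have dPhi := is_derive_Phi z; have dphi := is_derive_phi z.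
  have dinv : is_derive z 1 (fun y : R => (1 + y ^+ 2)^-1) (- (1 + z ^+ 2) ^- 2 * (2 * z)).
    have := @is_deriveV R (fun y : R => 1 + y ^+ 2) z (2 * z) 1.
    rewrite /GRing.scale /=; apply; first by rewrite gt_eqF.
    by apply: is_derive_eq; rewrite /GRing.scale /=; ring.
  have nz : 1 + z ^+ 2 != 0 by rewrite gt_eqF.
  by apply: is_derive_eq; rewrite /GRing.scale /=; field.
have le_v : v x <= 0.
  apply/ler_addgt0Pr => e e_gt0; rewrite add0r.
  pose C := normal_peak (1 : R); have C_gt0 : 0 < C by rewrite normal_peak_gt0 ?oner_eq0.
  (* As [C] bounds [phi], this [y] gives [y * phi y / (1 + y ^+ 2) <= C / y <= e]. *)
  pose y := Num.max x (C / e).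
  have xy : x <= y by rewrite le_max lexx.
  have y_gt0 : 0 < y := lt_le_trans x_gt0 xy.
  have Ce : C / e <= y by rewrite le_max lexx orbT.
  apply: le_trans (derive_ge0_le dv _ xy) _ => [z _|].
    by rewrite divr_ge0 ?sqr_ge0 // mulr_ge0 // ltW // phi_gt0.
  have phi_le : phi y <= C by apply: normal_pdf_ub; rewrite oner_eq0.
  have := Phi_le1 y; rewrite /v => Phi1.
  rewrite lerBlDr; apply: (@le_trans _ _ e); last by rewrite lerDl subr_ge0.
  rewrite ler_pdivrMr //; rewrite ler_pdivrMr // in Ce.
  have := phi_gt0 y; nra.
move: le_v; rewrite /v subr_le0 ler_pdivrMr // mulrC; congr (_ <= _).
by rewrite mulrC.
Qed.

End standard_normal.

Lemma lipschitz_continuous (R : realType) (f : R -> R) (L : R) : 0 <= L ->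
  (forall x y, `|f x - f y| <= L * `|x - y|) -> continuous f.
Proof.
move=> L_ge0 lip x; apply/cvgrPdist_lt => e e_gt0.
have L1_gt0 : 0 < L + 1 by rewrite ltr_pwDr.
near=> t; apply: le_lt_trans (lip x t) _.
have : `|x - t| < e / (L + 1).
  by near: t; apply: cvgr_dist_lt => //; apply: divr_gt0.
rewrite ltr_pdivlMr //; have := normr_ge0 (x - t); nra.
Unshelve. all: by end_near. Qed.

(** * The Stein equation for a ramp *)

Section stein_equation.
Variables (R : realType) (a b : R).
Hypothesis lt_ab : a < b.
Local Notation Phi := (@std_normal_cdf R).
Local Notation phi := (@phi R).
Local Notation mu := (@lebesgue_measure R).

(** A Lipschitz function lying between the indicators of the half-lines ending at [a] and at [b]. *)
Definition ramp (x : R) : R := Num.max 0 (Num.min 1 ((b - x) / (b - a))).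

Let ba_gt0 : 0 < b - a. Proof. by rewrite subr_gt0. Qed.

Lemma ramp_ge0 x : 0 <= ramp x. Proof. by rewrite le_max lexx. Qed.

Lemma ramp_le1 x : ramp x <= 1.
Proof. by rewrite ge_max ler01 ge_min lexx. Qed.

Lemma ramp_left x : x <= a -> ramp x = 1.
Proof.
move=> le_xa; rewrite /ramp min_l ?max_r ?ler01 //.
by rewrite ler_pdivlMr // mul1r lerD2l lerN2.
Qed.

Lemma ramp_right x : b <= x -> ramp x = 0.
Proof.
move=> le_bx; rewrite /ramp max_l // ge_min; apply/orP; right.
by rewrite ler_pdivrMr // mul0r subr_le0.
Qed.

Lemma ramp_lipschitz x y : `|ramp x - ramp y| <= (b - a)^-1 * `|x - y|.
Proof.
have -> : (b - a)^-1 * `|x - y| = `|(b - x) / (b - a) - (b - y) / (b - a)|.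
  rewrite -mulrBl normrM mulrC normfV (gtr0_norm ba_gt0) distrC; congr (`|_| * _).
  by ring.
rewrite /ramp; move: ((b - x) / _) ((b - y) / _) => u v.
rewrite ler_norml; have := ler_norm (u - v); have := ler_norm (v - u).
rewrite (distrC v) => ? ?.
rewrite /Num.max /Num.min.
case: (Order.TotalTheory.ltP 1 u) => ?; case: (Order.TotalTheory.ltP 1 v) => ?;
  do ?[case: Order.TotalTheory.ltP => ?]; lra.
Qed.

Lemma ramp_continuous : continuous ramp.
Proof. by apply: lipschitz_continuous ramp_lipschitz; rewrite invr_ge0 ltW. Qed.

Definition ramp_integral (x : R) : R := (\int[mu]_(t in `]-oo, x]) (ramp t * phi t))%R.

Lemma is_derive_ramp_integral (x : R) :
  is_derive x 1 ramp_integral (ramp x * phi x).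
Proof.
apply: (@is_derive_integralNy _ (fun t => ramp t * phi t)).
  by move=> y; apply: cvgM; [apply: ramp_continuous | apply: continuous_phi].
move=> y; have phi_ge0 := ltW (phi_gt0 y); rewrite mulr_ge0 ?ramp_ge0 //=.
by rewrite ler_piMl ?ramp_le1.
Qed.

Lemma ramp_integral_left x : x <= a -> ramp_integral x = Phi x.
Proof.
move=> le_xa; apply: eq_Rintegral => t; rewrite inE /= in_itv /= => le_tx.
by rewrite ramp_left ?mul1r // (le_trans le_tx).
Qed.

(** The full Gaussian expectation of [ramp], which vanishes to the right of [b]. *)
Definition ramp_mean : R := ramp_integral b.
Local Notation c := ramp_mean.

Lemma ramp_integral_right x : b <= x -> ramp_integral x = c.
Proof.
move=> le_bx; apply/eqP; rewrite eq_le; apply/andP; split.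
  apply: derive_le0_ge is_derive_ramp_integral _ le_bx => z /andP [/ltW bz _].
  by rewrite ramp_right // mul0r.
apply: derive_ge0_le is_derive_ramp_integral _ le_bx => z /andP [/ltW bz _].
by rewrite ramp_right // mul0r.
Qed.

Lemma ramp_mean_bounds : Phi a <= c <= Phi b.
Proof.
apply/andP; split.
  rewrite -(ramp_integral_left (lexx a)).
  apply: derive_ge0_le is_derive_ramp_integral _ (ltW lt_ab) => z _.
  by rewrite mulr_ge0 ?ramp_ge0 // ltW // phi_gt0.
have dD (z : R) : is_derive z 1 (fun y => Phi y - ramp_integral y) (phi z - ramp z * phi z).
  by have dG := is_derive_ramp_integral z; have dPhi := is_derive_Phi z; apply: is_deriveB.
rewrite -subr_ge0 -[leLHS](subrr (Phi a)) -{2}(ramp_integral_left (lexx a)).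
apply: (derive_ge0_le dD _ (ltW lt_ab)) => z _.
by rewrite subr_ge0 ler_piMl ?ramp_le1 // ltW // phi_gt0.
Qed.

Let c_ge0 : 0 <= c.
Proof. by case/andP: ramp_mean_bounds => le_c _; apply: le_trans le_c; apply: Phi_ge0. Qed.

Let c_le1 : c <= 1.
Proof. by case/andP: ramp_mean_bounds => _ /le_trans; apply; apply: Phi_le1. Qed.

(** The solution of [F' x - x * F x = ramp x - c] given by the integrating factor [phi];
    [stein_deriv] is its derivative. *)
Definition stein_fun (x : R) : R := (ramp_integral x - c * Phi x) / phi x.
Local Notation F := stein_fun.

Definition stein_deriv (x : R) : R := x * F x + ramp x - c.

Lemma is_derive_stein_fun (x : R) : is_derive x 1 F (stein_deriv x).
Proof.
have phi_neq0 : phi x != 0 by rewrite gt_eqF // phi_gt0.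
have dG := is_derive_ramp_integral x; have dPhi := is_derive_Phi x.
have dphi := is_derive_phi x.
have dinv := is_deriveV phi_neq0 dphi.
rewrite /stein_fun; apply: is_derive_eq.
by rewrite /GRing.scale /= /stein_deriv /stein_fun; field.
Qed.

Let G (x : R) : R := F x + x * stein_deriv x.

Lemma is_derive_mul_stein_fun (x : R) : is_derive x 1 (fun y => y * F y) (G x).
Proof.
have dF := is_derive_stein_fun x; apply: is_derive_eq.
by rewrite /GRing.scale /= /G; ring.
Qed.

(** The lower Mills bound gives nonnegativity; the upper one bounds the gap by [1 / y]. *)
Let mills_gap (y : R) : 1 <= y ->
  0 <= (1 + y ^+ 2) * ((1 - Phi y) / phi y) - y <= 1.
Proof.
move=> y_ge1; have y_gt0 := lt_le_trans ltr01 y_ge1; have phi_y := phi_gt0 y.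
have lo := mills_lower y_gt0; have up := mills_upper y_gt0.
rewrite subr_ge0 mulrA ler_pdivlMr // lo /= lerBlDr ler_pdivrMr //.
have := Phi_le1 y; nra.
Qed.

(** To the right of [b] the ramp is constant and [G] is [c] times the Mills gap; on the left,
    symmetry of [Phi] gives [1 - c] times the gap at [- x]. *)
Let G_right (x : R) : 1 <= x -> b <= x -> `|G x| <= 1.
Proof.
move=> x_ge1 le_bx; have /andP [gap_ge0 gap_le1] := mills_gap x_ge1.
have phi_neq0 : phi x != 0 by rewrite gt_eqF // phi_gt0.
have -> : G x = c * ((1 + x ^+ 2) * ((1 - Phi x) / phi x) - x).
  rewrite /G /stein_deriv /stein_fun ramp_right // ramp_integral_right //.
  by field.
rewrite ger0_norm ?mulr_ge0 //.
by rewrite -[leRHS]mulr1 ler_pM.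
Qed.

Let G_left (x : R) : x <= - 1 -> x <= a -> `|G x| <= 1.
Proof.
move=> x_le1 le_xa; have Nx_ge1 : 1 <= - x by lra.
have /andP [gap_ge0 gap_le1] := mills_gap Nx_ge1.
have phi_neq0 : phi x != 0 by rewrite gt_eqF // phi_gt0.
have -> : G x = (1 - c) * ((1 + (- x) ^+ 2) * ((1 - Phi (- x)) / phi (- x)) - - x).
  rewrite /G /stein_deriv /stein_fun ramp_left // ramp_integral_left // PhiN phiN.
  by field.
rewrite ger0_norm; last by apply: mulr_ge0 => //; rewrite subr_ge0.
by rewrite -[leRHS]mulr1; apply: ler_pM => //; have := c_ge0; have := c_le1; lra.
Qed.

Let G_bounded : exists2 L : R, 0 <= L & forall x, `|G x| <= L.
Proof.
pose A := Num.max 1 (Num.max (- a) b).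
have A_ge1 : 1 <= A by rewrite le_max lexx.
have Aa : - A <= a by rewrite lerNl !le_max lexx orbT.
have bA : b <= A by rewrite !le_max lexx !orbT.
have F_cont : continuous F := is_derive_continuous is_derive_stein_fun.
have G_cont : continuous G.
  move=> x; apply: cvgD; first exact: F_cont.
  apply: cvgM; first exact: cvg_id.
  apply: cvgB; last exact: cvg_cst.
  apply: cvgD; last exact: ramp_continuous.
  by apply: cvgM; [exact: cvg_id | exact: F_cont].
have Gn_cont : {within `[- A, A], continuous (fun x => `|G x|)}.
  by apply: continuous_subspaceT => x; apply: cvg_norm; apply: G_cont.
have le_AA : - A <= A by lra.
have [m _ mP] := EVT_max le_AA Gn_cont.
exists (Num.max 1 `|G m|) => [|x]; first by rewrite le_max ler01.
have [le_xA|lt_Ax] := leP x A; last first.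
  by rewrite le_max G_right ?(le_trans A_ge1) ?(le_trans bA) // ltW.
have [le_Ax|lt_xA] := leP (- A) x.
  by rewrite le_max mP ?orbT // in_itv /= le_Ax.
by rewrite le_max G_left //; lra.
Qed.

(** The Stein equation expresses the derivative as [x * F x] plus the ramp and a constant. The ramp
    is Lipschitz, and [x * F x] has the bounded derivative [G]. *)
Lemma stein_deriv_lipschitz : exists2 L : R, 0 <= L &
  forall x y, `|stein_deriv x - stein_deriv y| <= L * `|x - y|.
Proof.
have [L L_ge0 LP] := G_bounded.
exists (L + (b - a)^-1) => [|x y]; first by rewrite addr_ge0 // invr_ge0 ltW.
have -> : stein_deriv x - stein_deriv y = (x * F x - y * F y) + (ramp x - ramp y).
  by rewrite /stein_deriv; ring.
rewrite mulrDl; apply: le_trans (ler_normD _ _) _; apply: lerD (ramp_lipschitz x y).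
exact: (derive_bounded_lipschitz is_derive_mul_stein_fun LP).
Qed.

End stein_equation.

(** * Normal approximation for sums of independent Bernoulli variables *)

Section clt.
Variable R : realType.
Local Notation Phi := (@std_normal_cdf R).

Definition coef_cdf (p : {poly R}) (m s x : R) : R :=
  coef_int p (fun k => ((k%:R <= x * s + m)%R)%:R) / p.[1].

Definition root_cdf (rs : seq R) : R -> R :=
  coef_cdf (root_poly rs) (root_mean rs) (Num.sqrt (root_var rs)).

Lemma root_poly1_gt0 (rs : seq R) : all (> 0) rs -> 0 < (root_poly rs).[1].
Proof.
move=> rs_gt0; rewrite root_poly1 big_seq; apply: prodr_gt0 => r /(allP rs_gt0).
exact: addr_gt0.
Qed.

Lemma root_poly_coef_ge0W (rs : seq R) : all (> 0) rs -> forall k, 0 <= (root_poly rs)`_k.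
Proof. by move=> rs_gt0; apply: root_poly_coef_ge0; apply: sub_all rs_gt0 => z /ltW. Qed.

(** [root_poly_stein] is applied to the Stein solution at the standardized points [W k], spaced by
    [1 / s]. The Lipschitz bound makes the error [L / s ^+ 2], with [L] independent of [rs]. *)
Lemma ramp_expectation (a b : R) : a < b -> exists2 L : R, 0 <= L &
  forall rs, all (> 0) rs -> 0 < root_var rs ->
  `|coef_int (root_poly rs)
      (fun k => ramp a b ((k%:R - root_mean rs) / Num.sqrt (root_var rs))) /
    (root_poly rs).[1] - ramp_mean a b| <= L / Num.sqrt (root_var rs).
Proof.
move=> lt_ab; have [L L_ge0 lip] := stein_deriv_lipschitz lt_ab.
exists L => // rs rs_gt0 var_gt0; set s := Num.sqrt _; set p := root_poly rs; set m := root_mean rs.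
have s_gt0 : 0 < s by rewrite sqrtr_gt0.
have s_neq0 : s != 0 by rewrite gt_eqF.
have varE : root_var rs = s ^+ 2 by rewrite sqr_sqrtr // ltW.
have p1_gt0 := root_poly1_gt0 rs_gt0.
pose W k := (k%:R - m) / s.
pose f k := stein_fun a b (W k); pose g k := stein_deriv a b (W k) / s.
have WS k : W k.+1 - W k = s^-1 by rewrite /W -natr1; field.
have lt_W k : W k < W k.+1 by rewrite -subr_gt0 WS invr_gt0.
have mvt k : exists2 z, W k < z < W k.+1 & f k.+1 - f k = stein_deriv a b z / s.
  by have [z zP eq_z] := MVT_line (is_derive_stein_fun lt_ab) (lt_W k);
    exists z; rewrite // -(WS k).
have K k z w : W k <= z <= W k.+1 -> W k <= w <= W k.+1 ->
    `|stein_deriv a b z / s - stein_deriv a b w / s| <= L / s ^+ 2.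
  move=> /andP [z1 z2] /andP [w1 w2]; rewrite -mulrBl normrM normfV (gtr0_norm s_gt0).
  rewrite expr2 invfM mulrA ler_pM2r ?invr_gt0 //.
  apply: le_trans (lip z w) _; rewrite ler_wpM2l // -(WS k) ler_norml; lra.
have H0 k : `|f k.+1 - f k - g k| <= L / s ^+ 2.
  have [z /andP [/ltW z1 /ltW z2] ->] := mvt k.
  by apply: (K k); rewrite ?z1 ?z2 ?lexx ?(ltW (lt_W k)).
have H1 k : `|f k.+1 - f k - g k.+1| <= L / s ^+ 2.
  have [z /andP [/ltW z1 /ltW z2] ->] := mvt k.
  by apply: (K k); rewrite ?z1 ?z2 ?lexx ?(ltW (lt_W k)).
have bound := root_poly_stein rs_gt0 H0 H1.
rewrite -/p -/m varE -coef_intZ in bound.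
have {bound} : `|coef_int p (fun k => (k%:R - m) * f k + - (s ^+ 2 * g k))|
    <= L / s ^+ 2 * s ^+ 2 * p.[1].
  rewrite coef_intD; apply: le_trans bound.
  rewrite [X in `|_ + X|](_ : _ = - coef_int p (fun k => s ^+ 2 * g k)) //.
  by rewrite -[RHS]mulN1r -coef_intZ; apply: eq_coef_int => k; rewrite mulN1r.
(* The Stein equation turns the integrand into [- s] times the centred ramp, so dividing by [s]
   leaves an error [L / s]. *)
rewrite (@eq_coef_int _ _ _ (fun k => - s * (ramp a b (W k) + - ramp_mean a b * 1))); last first.
  by move=> k; rewrite /f /g /stein_deriv /W; field.
rewrite coef_intZ coef_intD coef_intZ coef_int1 normrM normrN (gtr0_norm s_gt0).
have -> : L / s ^+ 2 * s ^+ 2 * p.[1] = L * p.[1] by field.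
move=> bound.
have -> : coef_int p (fun k => ramp a b (W k)) / p.[1] - ramp_mean a b =
   (coef_int p (fun k => ramp a b (W k)) + - ramp_mean a b * p.[1]) / p.[1].
  by field; rewrite gt_eqF.
rewrite normrM normfV (gtr0_norm p1_gt0) ler_pdivrMr // mulrAC ler_pdivlMr //.
by rewrite mulrC.
Qed.

Section coefficient_cdf.
Variables (p : {poly R}) (m s : R).
Hypotheses (p_ge0 : forall k, 0 <= p`_k) (p1_gt0 : 0 < p.[1]).

Lemma coef_cdf_le x y : 0 <= s -> x <= y -> coef_cdf p m s x <= coef_cdf p m s y.
Proof.
move=> s_ge0 le_xy; rewrite /coef_cdf ler_pM2r ?invr_gt0 //.
apply: le_coef_int => // k; case: (Order.TotalTheory.leP k%:R (x * s + m)) => // le_k.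
by rewrite (le_trans le_k) // lerD2r ler_wpM2r.
Qed.

Lemma coef_cdf_ge0 x : 0 <= coef_cdf p m s x.
Proof.
rewrite /coef_cdf divr_ge0 ?(ltW p1_gt0) //; apply: sumr_ge0 => k _.
by rewrite mulr_ge0 // ler0n.
Qed.

Lemma coef_cdf_le1 x : coef_cdf p m s x <= 1.
Proof.
rewrite /coef_cdf ler_pdivrMr // mul1r -coef_int1; apply: le_coef_int => // k.
by rewrite lern1 leq_b1.
Qed.

End coefficient_cdf.

Lemma root_cdf_between (a b e : R) : a < b -> 0 < e -> exists V : R,
  forall rs, all (> 0) rs -> V < root_var rs ->
  root_cdf rs a <= Phi b + e /\ Phi a - e <= root_cdf rs b.
Proof.
move=> lt_ab e_gt0; have [L L_ge0 LP] := ramp_expectation lt_ab.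
(* Beyond this variance, [L / s <= e]. *)
exists ((L / e) ^+ 2) => rs rs_gt0 lt_V.
have var_gt0 : 0 < root_var rs by apply: le_lt_trans lt_V; apply: sqr_ge0.
have := LP rs rs_gt0 var_gt0; rewrite /root_cdf /coef_cdf.
set s := Num.sqrt _; set p := root_poly rs; set m := root_mean rs.
have s_gt0 : 0 < s by rewrite sqrtr_gt0.
have p_ge0 : forall k, 0 <= p`_k := root_poly_coef_ge0W rs_gt0.
have p1_gt0 : 0 < p.[1] := root_poly1_gt0 rs_gt0.
have Ls : L / s <= e.
  rewrite ler_pdivrMr // mulrC -ler_pdivrMr // ltW //.
  rewrite -(ger0_norm (divr_ge0 L_ge0 (ltW e_gt0))) -sqrtr_sqr ltr_sqrt //.
move/le_trans => /(_ _ Ls); rewrite ler_norml => /andP [low up].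
have /andP [mean_ge mean_le] := ramp_mean_bounds lt_ab.
have W_le k x : (k%:R <= x * s + m) = ((k%:R - m) / s <= x).
  by rewrite ler_pdivrMr // lerBlDr.
split.
  apply: (@le_trans _ _ (coef_int p (fun k => ramp a b ((k%:R - m) / s)) / p.[1])); last lra.
  rewrite ler_pM2r ?invr_gt0 //; apply: le_coef_int => // k; rewrite W_le.
  by case: (Order.TotalTheory.leP ((k%:R - m) / s) a) => [le_a|_];
    [rewrite (ramp_left lt_ab le_a) | exact: ramp_ge0].
apply: (@le_trans _ _ (coef_int p (fun k => ramp a b ((k%:R - m) / s)) / p.[1])); first lra.
rewrite ler_pM2r ?invr_gt0 //; apply: le_coef_int => // k; rewrite W_le.
by case: (Order.TotalTheory.leP ((k%:R - m) / s) b) => [_|/ltW ge_b];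
  [exact: ramp_le1 | rewrite (ramp_right lt_ab ge_b)].
Qed.

Lemma Phi_lipschitz : exists2 C : R, 0 < C & forall x y, `|Phi x - Phi y| <= C * `|x - y|.
Proof.
exists (normal_peak 1); first by rewrite normal_peak_gt0 ?oner_eq0.
apply: derive_bounded_lipschitz (@is_derive_Phi R) _ => x.
by rewrite ger0_norm ?(ltW (phi_gt0 x)) // normal_pdf_ub ?oner_eq0.
Qed.

(** Ramps on both sides of [t], of width [d] so small that [Phi] varies by at most [e / 2] over
    it. *)
Lemma root_cdf_cvg (t e : R) : 0 < e -> exists V : R,
  forall rs, all (> 0) rs -> V < root_var rs -> `|root_cdf rs t - Phi t| <= e.
Proof.
move=> e_gt0; have e2_gt0 : 0 < e / 2 by rewrite divr_gt0.
have [C C_gt0 lip] := Phi_lipschitz; pose d := e / 2 / C.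
have d_gt0 : 0 < d by rewrite divr_gt0.
have Cd : C * d = e / 2 by rewrite /d; field; rewrite gt_eqF.
have [|V1 V1P] := @root_cdf_between (t - d) t (e / 2) _ e2_gt0; first by lra.
have [|V2 V2P] := @root_cdf_between t (t + d) (e / 2) _ e2_gt0; first by lra.
exists (Num.max V1 V2) => rs rs_gt0; rewrite gt_max => /andP [lt1 lt2].
have [_ low] := V1P rs rs_gt0 lt1; have [up _] := V2P rs rs_gt0 lt2.
have := lip (t + d) t; rewrite addrAC subrr add0r (gtr0_norm d_gt0) Cd ler_norml.
have := lip t (t - d); rewrite opprB addrCA subrr addr0 (gtr0_norm d_gt0) Cd ler_norml.
rewrite ler_norml; lra.
Qed.

(** Pólya's argument: between neighbouring grid points [Phi] grows by at most [e], beyond the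
    extreme ones it is within [e] of its limit, and monotonicity controls [f] in between. The grid
    does not depend on [f]. *)
Lemma polya_grid (e : R) : 0 < e -> exists ts : seq R, forall f : R -> R,
  {homo f : x y / x <= y} -> (forall x, 0 <= f x <= 1) ->
  (forall t, t \in ts -> `|f t - Phi t| <= e) -> forall x, `|f x - Phi x| <= 2 * e.
Proof.
move=> e_gt0; have [C C_gt0 lip] := Phi_lipschitz; pose d := e / C.
have d_gt0 : 0 < d by rewrite divr_gt0.
have Cd : C * d = e by rewrite /d; field; rewrite gt_eqF.
have [M0 M0P] := @Phi_near0 R e e_gt0; have [M1 M1P] := @Phi_near1 R e e_gt0.
pose t0 := M0 - 1; pose t (i : nat) := t0 + i%:R * d.
have step i : Phi (t i.+1) <= Phi (t i) + e.
  have := lip (t i.+1) (t i).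
  have -> : t i.+1 - t i = d by rewrite /t -natr1; ring.
  by rewrite (gtr0_norm d_gt0) Cd ler_norml; lra.
have Phi0 : Phi (t 0%N) < e by apply: M0P; rewrite /t mul0r addr0 /t0; lra.
pose N := Num.bound (`|M1 - t0| / d).
have PhiN : 1 - Phi (t N) < e.
  apply: M1P; have := @archi_boundP R (`|M1 - t0| / d).
  rewrite divr_ge0 ?(ltW d_gt0) // => /(_ isT); rewrite -/N ltr_pdivrMr // /t.
  by have := ler_norm (M1 - t0); lra.
exists [seq t i | i <- iota 0 N.+1] => f f_homo f_01 f_ts x.
have near_t i : (i <= N)%N -> `|f (t i) - Phi (t i)| <= e.
  by move=> le_iN; apply: f_ts; apply: map_f; rewrite mem_iota.
have [le_xN|lt_Nx] := Order.TotalTheory.leP x (t N); last first.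
  have := near_t N (leqnn N); have := f_homo _ _ (ltW lt_Nx).
  have /andP [_ f1] := f_01 x; have := Phi_le (ltW lt_Nx); have := Phi_le1 x.
  rewrite !ler_norml; lra.
elim: N {PhiN f_ts} near_t le_xN => [|N IHN] near_t le_xN.
  have := near_t 0%N (leqnn 0); have := f_homo _ _ le_xN; have := Phi_le le_xN.
  have /andP [f0 _] := f_01 x; have := Phi_ge0 x; rewrite !ler_norml; lra.
have [le_x|lt_x] := Order.TotalTheory.leP x (t N).
  by apply: IHN => // i le_iN; apply: near_t; rewrite ltnW.
have := near_t N (leqnSn N); have := near_t N.+1 (leqnn _); have := step N.
have := f_homo _ _ le_xN; have := f_homo _ _ (ltW lt_x).
have := Phi_le le_xN; have := Phi_le (ltW lt_x).
rewrite !ler_norml; lra.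
Qed.

Lemma root_cdf_cvg_uniform (e : R) : 0 < e -> exists V : R, forall rs,
  all (> 0) rs -> V < root_var rs -> forall x, `|root_cdf rs x - Phi x| <= e.
Proof.
move=> e_gt0; have e2_gt0 : 0 < e / 2 by rewrite divr_gt0.
have [ts tsP] := polya_grid e2_gt0.
have [V VP] : exists V : R, forall rs, all (> 0) rs -> V < root_var rs ->
    forall t, t \in ts -> `|root_cdf rs t - Phi t| <= e / 2.
  elim: ts {tsP} => [|t ts [V VP]]; first by exists 0.
  have [Vt VtP] := root_cdf_cvg t e2_gt0.
  exists (Num.max V Vt) => rs rs_gt0; rewrite gt_max => /andP [lt_V lt_Vt] u.
  by rewrite inE => /orP [/eqP ->|/VP]; [apply: VtP | apply].
exists V => rs rs_gt0 lt_V x.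
rewrite (_ : e = 2 * (e / 2)); last by field.
have p_ge0 := root_poly_coef_ge0W rs_gt0; have p1_gt0 := root_poly1_gt0 rs_gt0.
apply: tsP => [y z|y|t]; last exact: VP.
- by apply: coef_cdf_le => //; apply: sqrtr_ge0.
- by rewrite coef_cdf_ge0 //= coef_cdf_le1.
Qed.

End clt.

(** * The polynomials over even and odd signed permutations *)

Section coefficient_moments.
Variable R : realFieldType.
Implicit Types p q : {poly R}.

Lemma coef_int_deriv p (g : nat -> R) :
  coef_int p^`() g = coef_int p (fun k => k%:R * g k.-1).
Proof.
rewrite (@coef_int_widen _ _ _ (size p)); last first.
  have [->|p_neq0] := eqVneq p 0; first by rewrite deriv0.
  exact: ltnW (lt_size_deriv p_neq0).
rewrite (@coef_int_widen _ _ _ (size p).+1) ?leqnSn // big_ord_recl mul0r mulr0 add0r.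
by apply: eq_bigr => k _; rewrite coef_deriv lift0 mulrCA mulrA mulr_natl.
Qed.

Lemma coef_int_id p : coef_int p (fun k => k%:R) = p^`().[1].
Proof.
by rewrite -coef_int1 coef_int_deriv; apply: eq_coef_int => k; rewrite mulr1.
Qed.

Lemma coef_int_sqr p : coef_int p (fun k => k%:R ^+ 2) = p^`()^`().[1] + p^`().[1].
Proof.
rewrite -coef_int_id coef_int_deriv -coef_int_id -coef_intD; apply: eq_coef_int.
by case=> [|k] /=; rewrite -?natr1; ring.
Qed.

Lemma coef_int_var p (m : R) : coef_int p (fun k => (k%:R - m) ^+ 2) =
  p^`()^`().[1] + p^`().[1] - 2 * m * p^`().[1] + m ^+ 2 * p.[1].
Proof.
rewrite (@eq_coef_int _ _ _ (fun k => k%:R ^+ 2 + (- (2 * m) * k%:R + m ^+ 2 * 1))).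
  by rewrite !(coef_intD, coef_intZ) coef_int_sqr coef_int_id coef_int1; ring.
by move=> k; ring.
Qed.

(** Stein's identity is exact ([K = 0]) for [f = 1] and [g = 0]; the variance comes likewise from
    [f k = k] and [g = 1]. *)
Lemma root_poly_mean (rs : seq R) : all (> 0) rs ->
  (root_poly rs)^`().[1] = root_mean rs * (root_poly rs).[1].
Proof.
move=> rs_gt0; have := @root_poly_stein _ rs (fun=> 1) (fun=> 0) 0 rs_gt0.
rewrite !subrr normr0 => /(_ (fun=> lexx 0) (fun=> lexx 0)).
rewrite (@eq_coef_int _ _ (fun=> 0) (fun=> 0 * 1)); last by move=> k; rewrite mul0r.
rewrite coef_intZ !mul0r mulr0 subr0 normr_le0.
rewrite (@eq_coef_int _ _ _ (fun k => k%:R + (- root_mean rs) * 1)); last by move=> k; ring.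
by rewrite coef_intD coef_intZ coef_int_id coef_int1 mulNr subr_eq0 => /eqP.
Qed.

Lemma root_poly_var (rs : seq R) : all (> 0) rs ->
  (root_poly rs)^`()^`().[1] + (root_poly rs)^`().[1] =
  (root_var rs + root_mean rs ^+ 2) * (root_poly rs).[1].
Proof.
move=> rs_gt0; have := @root_poly_stein _ rs (fun k => k%:R) (fun=> 1) 0 rs_gt0.
have zero k : `|k.+1%:R - k%:R - 1| <= 0 :> R.
  by rewrite (_ : _ - _ - _ = 0) ?normr0 // -natr1; ring.
move=> /(_ zero zero); rewrite !mul0r normr_le0.
rewrite (@eq_coef_int _ _ _ (fun k => k%:R ^+ 2 + (- root_mean rs) * k%:R)); last first.
  by move=> k; ring.
rewrite coef_intD coef_intZ coef_int_sqr coef_int_id coef_int1 root_poly_mean //.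
by rewrite subr_eq0 => /eqP eq_var; rewrite mulrDl -eq_var; ring.
Qed.

End coefficient_moments.

Section statistic_polynomial.
Variables (R : realType) (T : finType) (S : {set T}) (stat : T -> nat).
Local Notation p := (stat_poly R S stat).

Lemma stat_poly_int (f : nat -> R) : coef_int p f = \sum_(x in S) f (stat x).
Proof.
pose n := maxn (size p) (\max_(x in S) stat x).+1.
rewrite (@coef_int_widen _ _ _ n) ?leq_maxl //.
under eq_bigr do rewrite /stat_poly coef_sum big_distrl /=.
rewrite exchange_big /=; apply: eq_bigr => x xS.
have lt_n : (stat x < n)%N by rewrite /n leq_max ltnS leq_bigmax_cond ?orbT.
rewrite (bigD1 (Ordinal lt_n)) //= coefXn eqxx mul1r big1 ?addr0 // => k neq_k.
by rewrite coefXn -val_eqE /= in neq_k *; rewrite (negPf neq_k) mul0r.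
Qed.

Lemma stat_poly1 : p.[1] = #|S|%:R.
Proof. by rewrite -coef_int1 stat_poly_int sumr_const. Qed.

Lemma stat_poly_coef_ge0 k : 0 <= p`_k.
Proof. by rewrite coef_sum sumr_ge0 // => x _; rewrite coefXn ler0n. Qed.

Lemma coef_meanE (q : {poly R}) : coef_mean q = coef_int q (fun k => k%:R) / q.[1].
Proof. by rewrite /coef_mean big_distrl; apply: eq_bigr => k _; rewrite /coef_prob /=; ring. Qed.

Lemma coef_varE (q : {poly R}) :
  coef_var q = coef_int q (fun k => (k%:R - coef_mean q) ^+ 2) / q.[1].
Proof. by rewrite /coef_var big_distrl; apply: eq_bigr => k _; rewrite /coef_prob /=; ring. Qed.

Lemma unif_mean_stat_poly : unif_mean R S stat = coef_mean p.
Proof. by rewrite coef_meanE stat_poly_int stat_poly1. Qed.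

Lemma unif_var_stat_poly : unif_var R S stat = coef_var p.
Proof. by rewrite coef_varE stat_poly_int stat_poly1 -unif_mean_stat_poly. Qed.

End statistic_polynomial.

(** * Moments and limit law of the half-sums and half-differences *)

Section half_eulerian.
Variables (R : realType) (e : R).
Hypothesis e1 : `|e| = 1.

(** The even class corresponds to [e = 1], the odd class to [e = -1]. *)
Definition half_eulerian (n : nat) : {poly R} :=
  2^-1 *: (eulerianB R n + e *: (1 - 'X) ^+ n).
Local Notation Q := half_eulerian.
Local Notation B := (eulerianB R).

Lemma one_subX_root n : ((1 - 'X) ^+ n.+1).[1] = 0 :> R.
Proof. by rewrite horner_exp hornerD hornerN hornerX hornerC subrr expr0n. Qed.

Lemma deriv_one_subX n : deriv ((1 - 'X) ^+ n.+1) = (- n.+1%:R) *: (1 - 'X) ^+ n :> {poly R}.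
Proof.
rewrite deriv_exp derivD derivN derivX derivC add0r mulN1r /=.
by rewrite mulNrn scaleNr scaler_nat.
Qed.

(** [(1 - 'X) ^+ n] vanishes to order [n] at 1, so it does not affect derivatives of order less than
    [n]; this is the origin of the thresholds 1, 2 and 3. *)
Lemma half_eulerian1 n : (1 <= n)%N -> (Q n).[1] = (B n).[1] / 2.
Proof.
by case: n => // n _; rewrite hornerZ hornerD hornerZ one_subX_root; field.
Qed.

Lemma deriv_half_eulerian1 n : (2 <= n)%N -> (Q n)^`().[1] = (B n)^`().[1] / 2.
Proof.
case: n => [|[|n]] // _; rewrite derivZ derivD derivZ deriv_one_subX.
by rewrite !(hornerZ, hornerD) one_subX_root; field.
Qed.

Lemma deriv2_half_eulerian1 n : (3 <= n)%N -> (Q n)^`()^`().[1] = (B n)^`()^`().[1] / 2.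
Proof.
case: n => [|[|[|n]]] // _; rewrite !(derivZ, derivD) deriv_one_subX derivZ deriv_one_subX.
by rewrite !(hornerZ, hornerD) one_subX_root; field.
Qed.

Lemma half_eulerian1_gt0 n : (1 <= n)%N -> 0 < (Q n).[1].
Proof. by move=> n_ge1; rewrite half_eulerian1 // divr_gt0 // eulerianB1_gt0. Qed.

Lemma half_eulerian_mean n : (2 <= n)%N -> coef_mean (Q n) = n%:R / 2.
Proof.
move=> n_ge2; rewrite coef_meanE coef_int_id deriv_half_eulerian1 //.
rewrite half_eulerian1 ?(ltnW n_ge2) // deriv_eulerianB1.
by field; rewrite gt_eqF // eulerianB1_gt0.
Qed.

Lemma half_eulerian_var n : (3 <= n)%N -> coef_var (Q n) = (n%:R + 1) / 12.
Proof.
move=> n_ge3; have n_ge2 := ltnW n_ge3; have n_ge1 := ltnW n_ge2.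
rewrite coef_varE coef_int_var deriv2_half_eulerian1 // deriv_half_eulerian1 //.
rewrite half_eulerian1 // deriv2_eulerianB1 // deriv_eulerianB1 half_eulerian_mean //.
by field; rewrite gt_eqF // eulerianB1_gt0.
Qed.

Lemma eulerianB_root_poly n : exists2 rs : seq R, all (> 0) rs & B n = root_poly rs.
Proof.
have [x [x_lt0 _ ->]] := eulerianB_real_rooted R n.
exists [seq - x i | i <- iota 0 n].
  by apply/allP => _ /mapP [i + ->]; rewrite mem_iota oppr_gt0 => /andP [_ /x_lt0].
rewrite /root_poly big_map -(big_mkord xpredT (fun i => 'X - (x i)%:P)) /index_iota subn0.
by apply: eq_bigr => i _; rewrite polyCN.
Qed.

Lemma norm_coef_one_subX n k : `|((1 - 'X : {poly R}) ^+ n)`_k| <= ((1 + 'X) ^+ n)`_k.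
Proof.
elim: n k => [|n IHn] k; first by rewrite !expr0 coef1 ger0_norm // ler0n.
rewrite !exprS mulrBl mulrDl !mul1r coefB coefD !coefXM.
apply: le_trans (ler_normB _ _) _; apply: lerD => //.
by case: k => [|k] //=; rewrite normr0.
Qed.

Lemma coef_int_one_subX n (f : nat -> R) : (forall k, `|f k| <= 1) ->
  `|coef_int ((1 - 'X) ^+ n) f| <= 2 ^+ n.
Proof.
move=> f_le1; pose N := maxn (size ((1 - 'X : {poly R}) ^+ n)) (size ((1 + 'X : {poly R}) ^+ n)).
have -> : 2 ^+ n = coef_int ((1 + 'X : {poly R}) ^+ n) (fun=> 1 : R).
  by rewrite -[RHS]/(coef_int _ (fun=> 1)) coef_int1 horner_exp hornerD hornerX hornerC.
rewrite !(@coef_int_widen _ _ _ N) ?leq_maxl ?leq_maxr //.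
apply: le_trans (ler_norm_sum _ _ _) _; apply: ler_sum => k _.
by rewrite normrM ler_pM // norm_coef_one_subX.
Qed.

(** The absolute values of the coefficients of [(1 - 'X) ^+ n] sum to at most [2 ^ n], against a
    total mass [2 ^ n * n!]; the quotient [1 / n!] is at most [1 / n]. *)
Lemma half_eulerian_cdf n m s x : (1 <= n)%N ->
  `|coef_cdf (Q n) m s x - coef_cdf (B n) m s x| <= n%:R^-1.
Proof.
move=> n_ge1; set f := fun k : nat => ((k%:R <= x * s + m)%R)%:R : R.
have f_le1 k : `|f k| <= 1 by rewrite /f normr_nat lern1 leq_b1.
have B1_gt0 := eulerianB1_gt0 R n.
have -> : coef_cdf (Q n) m s x - coef_cdf (B n) m s x =
    e * coef_int ((1 - 'X) ^+ n) f / (B n).[1].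
  rewrite /coef_cdf half_eulerian1 // -/f /half_eulerian scalerDr scalerA.
  by rewrite coef_int_linear; field; rewrite gt_eqF.
rewrite !normrM e1 mul1r normfV (gtr0_norm B1_gt0) ler_pdivrMr //.
apply: le_trans (coef_int_one_subX n f_le1) _.
rewrite eulerianB1 natrM natrX mulrCA -[leLHS]mulr1 ler_pM2l ?exprn_gt0 //.
rewrite ler_pdivlMl ?ltr0n // mulr1 ler_nat.
by case: n n_ge1 {f_le1 B1_gt0} => // n _; rewrite factS leq_pmulr // fact_gt0.
Qed.

Lemma eulerianB_cdf_cvg (eps : R) : 0 < eps -> exists N : nat, forall n, (N <= n)%N ->
  forall x, `|coef_cdf (B n) (n%:R / 2) (Num.sqrt ((n%:R + 1) / 12)) x -
              std_normal_cdf x| <= eps.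
Proof.
move=> eps_gt0; have [V VP] := root_cdf_cvg_uniform eps_gt0.
(* From 2 on, the second derivative has its closed form; the other bound forces [(n + 1) / 12] above
   [V]. *)
exists (maxn 2 (Num.bound (12 * `|V|))) => n; rewrite geq_max => /andP [n_ge2 n_ge] x.
have [rs rs_gt0 Brs] := eulerianB_root_poly n.
have B1_neq0 : (B n).[1] != 0 by rewrite gt_eqF // eulerianB1_gt0.
have meanE : root_mean rs = n%:R / 2.
  have := root_poly_mean rs_gt0; rewrite -Brs deriv_eulerianB1.
  by move/(mulIf B1_neq0).
have varE : root_var rs = (n%:R + 1) / 12.
  have := root_poly_var rs_gt0; rewrite -Brs deriv2_eulerianB1 // deriv_eulerianB1.
  rewrite -mulrDl => /(mulIf B1_neq0); rewrite meanE => eq_var.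
  by apply: (addIr ((n%:R / 2) ^+ 2)); rewrite -eq_var; field.
have := VP rs rs_gt0; rewrite /root_cdf -Brs meanE varE; apply.
have := @archi_boundP R (12 * `|V|); rewrite mulr_ge0 // => /(_ isT) bound.
have := ler_norm V; have : (Num.bound (12 * `|V|))%:R <= n%:R :> R by rewrite ler_nat.
by rewrite ltr_pdivlMr //; lra.
Qed.

Lemma half_eulerian_normal (P : nat -> {poly R}) : (forall n, P n = Q n) ->
  (forall n k, 0 <= (P n)`_k) -> asymptotically_normal P.
Proof.
move=> PQ P_ge0; split.
  exists 1%N => // n /= n_ge1; split; first exact: P_ge0.
  by rewrite PQ half_eulerian1_gt0.
apply/cvgrPdist_le => eps eps_gt0; have eps2_gt0 : 0 < eps / 2 by rewrite divr_gt0.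
have [N NP] := eulerianB_cdf_cvg eps2_gt0.
(* The variance formula holds from 3 on, [N] controls the distance of [B n] to the normal law, and
   the last bound gives [n%:R^-1 <= eps / 2]. *)
exists (maxn (maxn 3 N) (Num.bound (2 / eps))) => // n /=.
rewrite !geq_max => /andP [/andP [n_ge3 n_geN] n_bound].
have n_ge1 : (1 <= n)%N by apply: leq_trans n_ge3.
have n_inv : n%:R^-1 <= eps / 2.
  rewrite -[leRHS]invrK lef_pV2 ?posrE ?ltr0n ?invr_gt0 // invf_div.
  apply: ltW; apply: lt_le_trans (archi_boundP _) _; last by rewrite ler_nat.
  by rewrite divr_ge0 // ltW.
have close x : `|(\sum_(k < size (P n) |
      k%:Z <= Num.floor (x * Num.sqrt (coef_var (P n)) + coef_mean (P n)))
    coef_prob (P n) k) - std_normal_cdf x| <= eps.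
  have -> : \sum_(k < size (P n) |
      k%:Z <= Num.floor (x * Num.sqrt (coef_var (P n)) + coef_mean (P n)))
      coef_prob (P n) k = coef_cdf (Q n) (n%:R / 2) (Num.sqrt ((n%:R + 1) / 12)) x.
    rewrite PQ half_eulerian_mean ?(ltnW n_ge3) // half_eulerian_var //.
    rewrite /coef_cdf /coef_int big_distrl big_mkcond; apply: eq_bigr => k _ /=.
    by rewrite floor_ge_int -pmulrn /coef_prob; case: ifP => _; rewrite ?mulr1 // mulr0 mul0r.
  have := NP n n_geN x; have := half_eulerian_cdf (n%:R / 2) (Num.sqrt ((n%:R + 1) / 12)) x n_ge1.
  rewrite !ler_norml; lra.
rewrite sub0r normrN ger0_norm /normal_distance.
  by apply: ge_sup => [|_ [x _ <-]]; [eexists; exists 0 | apply: close].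
(* Nonnegativity of the supremum: it dominates its element at 0, because [close] bounds the set. *)
apply: le_trans (ub_le_sup _ (imageT _ (0 : R))); first exact: normr_ge0.
by exists eps => _ [x _ <-]; apply: close.
Qed.

End half_eulerian.

Lemma stat_poly_half_plus (R : realType) (n : nat) (stat : {perm letter n} -> nat) :
  \sum_(pi in signed_perms n) 'X^(stat pi) = eulerianB R n ->
  \sum_(pi in signed_perms n) (-1) ^+ inv_B pi * 'X^(stat pi) =
    (1 - 'X) ^+ n :> {poly R} ->
  stat_poly R (signed_perms_plus n) stat = half_eulerian 1 n.
Proof. by move=> gf signed; rewrite /half_eulerian scale1r -(even_gf gf signed). Qed.

Lemma stat_poly_half_minus (R : realType) (n : nat) (stat : {perm letter n} -> nat) :
  \sum_(pi in signed_perms n) 'X^(stat pi) = eulerianB R n ->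
  \sum_(pi in signed_perms n) (-1) ^+ inv_B pi * 'X^(stat pi) =
    (1 - 'X) ^+ n :> {poly R} ->
  stat_poly R (signed_perms_minus n) stat = half_eulerian (-1) n.
Proof. by move=> gf signed; rewrite /half_eulerian scaleN1r -(odd_gf gf signed). Qed.

Theorem theorem3p4 (R : realType) :
  [/\ asymptotically_normal (BExc_plus R),
      asymptotically_normal (BExc_minus R),
      asymptotically_normal (B_plus R) &
      asymptotically_normal (B_minus R)] /\
  (forall n : nat, (2 <= n)%N ->
    [/\ unif_mean R (signed_perms_plus n) (@exc_B n) = n%:R / 2,
        unif_mean R (signed_perms_minus n) (@exc_B n) = n%:R / 2,
        unif_mean R (signed_perms_plus n) (@des_B n) = n%:R / 2 &
        unif_mean R (signed_perms_minus n) (@des_B n) = n%:R / 2]) /\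
  (forall n : nat, (3 <= n)%N ->
    [/\ unif_var R (signed_perms_plus n) (@exc_B n) = (n%:R + 1) / 12,
        unif_var R (signed_perms_minus n) (@exc_B n) = (n%:R + 1) / 12,
        unif_var R (signed_perms_plus n) (@des_B n) = (n%:R + 1) / 12 &
        unif_var R (signed_perms_minus n) (@des_B n) = (n%:R + 1) / 12]).
Proof.
have excP n := stat_poly_half_plus (@exc_B_gf R n) (signed_sum_exc _ _).
have excM n := stat_poly_half_minus (@exc_B_gf R n) (signed_sum_exc _ _).
have desP n := stat_poly_half_plus (@des_B_gf R n) (signed_sum_des _ _).
have desM n := stat_poly_half_minus (@des_B_gf R n) (signed_sum_des _ _).
have normN1 : `|-1 : R| = 1 by rewrite normrN1.
have norm1 : `|1 : R| = 1 by rewrite normr1.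
split; last split.
- split; [apply: (half_eulerian_normal norm1) | apply: (half_eulerian_normal normN1)
    | apply: (half_eulerian_normal norm1) | apply: (half_eulerian_normal normN1)];
    do ?[by move=> n k; apply: stat_poly_coef_ge0].
  + exact: excP.
  + exact: excM.
  + exact: desP.
  + exact: desM.
- by move=> n n_ge2; rewrite !unif_mean_stat_poly excP excM desP desM !half_eulerian_mean.
- by move=> n n_ge3; rewrite !unif_var_stat_poly excP excM desP desM !half_eulerian_var.
Qed.
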